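(* Let $n\ge 3$ be an integer and let $M=\{(x,f(x)) : x\in\mathbb R^n\}\subset\mathbb R^{n+1}$ be an entire graph, i.e. the graph of a $C^2$ function $f:\mathbb R^n\to\mathbb R$. If the Ricci curvature of $M$ is negative (at every point and in every tangent direction), then $$\inf_M|A|=0,$$ where $|A|$ is the length of the second fundamental form of $M$ in $\mathbb R^{n+1}$.
   Context: The graph $M$ is oriented by a choice of continuous unit normal field. Let $A$ denote the shape operator of $M$ and $k_1(p)\le\dots\le k_n(p)$ the principal curvatures (eigenvalues of $A$) at $p\in M$. The length of the second fundamental form is $|A|(p)=\big(\operatorname{trace}A^2(p)\big)^{1/2}=\big(\sum_{i=1}^n k_i(p)^2\big)^{1/2}$, and the mean curvature is $H=\frac1n\sum_{i=1}^n k_i$. If $e_1,\dots,e_n$ is an orthonormal basis of $T_pM$ with $A(e_i)=k_ie_i$, the (normalized) Ricci curvature is given by the Gauss equation as $(n-1)\operatorname{Ric}_p(e_i)=\sum_{j\ne i}k_ik_j=k_i(nH-k_i)$; for a general unit vector $v\in T_pM$, $(n-1)\operatorname{Ric}_p(v)=nH\langle Av,v\rangle-\|Av\|^2$. Negative Ricci curvature means $\operatorname{Ric}_p(v)<0$ for all $p\in M$ and all unit $v\in T_pM$; equivalently, $k_i(nH-k_i)<0$ for all $i$ at every point of $M$. *)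

(* Defs.v *)
From mathcomp Require Import all_boot all_order all_algebra.
From mathcomp Require Import all_classical all_reals all_analysis.

Set Implicit Arguments.
Unset Strict Implicit.
Unset Printing Implicit Defensive.

Import Order.TTheory GRing.Theory Num.Theory.
Import numFieldNormedType.Exports.

Local Open Scope classical_set_scope.
Local Open Scope ring_scope.

(* The norm [`|v|] of the library on row vectors is the sup norm; metric
   notions below use the Euclidean inner product instead. *)
Definition dotv (R : realType) (m : nat) (u v : 'rV[R]_m) : R :=
  (u *m v^T) 0 0.

Definition enorm (R : realType) (m : nat) (v : 'rV[R]_m) : R :=
  Num.sqrt (dotv v v).

(* In finite dimension, continuity of the differential is the same as
   continuity of [x |-> 'D_v g x] for every fixed vector [v]. *)
Fixpoint of_class_C (R : realType) (n k : nat) (g : 'rV[R]_n -> R) : Prop :=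
  if k is k'.+1 then
    (forall x, differentiable g x) /\ (forall v, of_class_C k' ('D_v g))
  else continuous g.

Section Graph.
Variables (R : realType) (n : nat) (f : 'rV[R]_n -> R).

Definition chart (x : 'rV[R]_n) : 'rV[R]_(n + 1) := row_mx x (f x)%:M.

Definition graph : set 'rV[R]_(n + 1) := range chart.

(* For [p] in the graph, [lsubmx p] is the parameter of [p], and the rows of
   this matrix are the coordinate vectors, which form a basis of [T_p M].
   Library Jacobians act on the right of row vectors:
   [u *m 'J g x] is the derivative of [g] at [x] along [u]. *)
Definition tangent_basis (p : 'rV[R]_(n + 1)) : 'M[R]_(n, n + 1) :=
  'J chart (lsubmx p).

Definition tangent (p v : 'rV[R]_(n + 1)) : bool :=
  (v <= tangent_basis p)%MS.

Definition unit_normal_field (N : 'rV[R]_(n + 1) -> 'rV[R]_(n + 1)) : Prop :=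
  {within graph, continuous N} /\
  forall p, graph p ->
    enorm (N p) = 1 /\ (forall v, tangent p v -> dotv v (N p) = 0).

Variable N : 'rV[R]_(n + 1) -> 'rV[R]_(n + 1).

(* [A v = - dN_p v] for [v] tangent at [p]. As [N] lives on the graph only,
   [dN_p v] is computed in the chart: [v *m pinvmx (tangent_basis p)] is the
   vector [u] of coordinates of [v], and [dN_p v] is the derivative of
   [N \o chart] along [u]. *)
Definition shape (p v : 'rV[R]_(n + 1)) : 'rV[R]_(n + 1) :=
  - (v *m pinvmx (tangent_basis p) *m 'J (N \o chart) (lsubmx p)).

(* The matrix of the endomorphism [A] of [T_p M] in the basis
   [tangent_basis p]: row [i] holds the coordinates of the image of the
   [i]-th basis vector. *)
Definition shape_mx (p : 'rV[R]_(n + 1)) : 'M[R]_n :=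
  \matrix_(i < n)
    (shape p (row i (tangent_basis p)) *m pinvmx (tangent_basis p)).

(* The eigenvalues of [A], repeated according to multiplicity, in
   nondecreasing order. They exist on the graph of a C^2 function, where [A]
   is self-adjoint; the default value of [xget] is then irrelevant. *)
Definition principal_curvatures (p : 'rV[R]_(n + 1)) : n.-tuple R :=
  xget (nseq_tuple n 0)
    [set k : n.-tuple R | sorted <=%R k /\
       char_poly (shape_mx p) = \prod_(c <- k) ('X - c%:P)].

Definition mean_curvature (p : 'rV[R]_(n + 1)) : R :=
  n%:R^-1 * \sum_(c <- principal_curvatures p) c.

Definition normA (p : 'rV[R]_(n + 1)) : R :=
  Num.sqrt (\tr (shape_mx p *m shape_mx p)).

Definition Ric (p v : 'rV[R]_(n + 1)) : R :=
  (n%:R * mean_curvature p * dotv (shape p v) v - enorm (shape p v) ^+ 2)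
  / (n%:R - 1).

Definition negative_Ricci : Prop :=
  forall p v, graph p -> tangent p v -> enorm v = 1 -> Ric p v < 0.

End Graph.

(* Main.v *)
(* Let k_1, ..., k_n be the principal curvatures and S their sum.  Negative
   Ricci curvature says k_i (S - k_i) < 0 for all i, so no k_i vanishes.  If
   two of them, k_l and k_m, are negative and all are at most e, then
   S - k_m > 0 forces -k_l < n e: all curvatures are of size at most n e.
   Symmetrically when two are positive and all are at least -e.

   Subtract from f the barrier 12/e^3 / (6/e^2 - |x|^2), whose graph has
   curvatures at most e and which blows up on the boundary of a ball.  At a
   maximum of the difference all k_i <= e, and the same applied to -f gives a
   point where all k_i >= -e.  If neither pinching argument applied, the first
   point would have at most one negative curvature and the second at most one
   positive, hence (n >= 3) at least two negative.  But the k_i never vanish,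
   so having at least two negative curvatures is an open and closed condition
   on R^n: it means that the Hessian is negative definite on some plane, and
   its negation that the Hessian is positive definite on some hyperplane. *)
Require Import Defs.
From mathcomp Require Import all_boot all_order all_algebra.
From mathcomp Require Import all_classical all_reals all_analysis.
From mathcomp Require Import complex ring lra.
Import Order.TTheory GRing.Theory Num.Theory.
Import numFieldNormedType.Exports.
Local Open Scope classical_set_scope.
Local Open Scope ring_scope.

Set Implicit Arguments.
Unset Strict Implicit.
Unset Printing Implicit Defensive.

(** * The Euclidean inner product on row vectors *)

Section DotProduct.
Context {R : realType} {m : nat}.
Implicit Types u v w : 'rV[R]_m.

Lemma dotvE u v : dotv u v = \sum_i u 0 i * v 0 i.
Proof. by rewrite /dotv mxE; apply: eq_bigr => i _; rewrite mxE. Qed.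

Lemma dotvv_ge0 u : 0 <= dotv u u.
Proof. by rewrite dotvE sumr_ge0 // => i _; rewrite -expr2 sqr_ge0. Qed.

Lemma dotvC u v : dotv u v = dotv v u.
Proof. by rewrite !dotvE; apply: eq_bigr => i _; rewrite mulrC. Qed.

Lemma dotvDl u v w : dotv (u + v) w = dotv u w + dotv v w.
Proof. by rewrite /dotv mulmxDl mxE. Qed.

Lemma dotvDr u v w : dotv w (u + v) = dotv w u + dotv w v.
Proof. by rewrite dotvC dotvDl !(dotvC _ w). Qed.

Lemma dotvZl a u v : dotv (a *: u) v = a * dotv u v.
Proof. by rewrite /dotv -scalemxAl mxE. Qed.

Lemma dotvZr a u v : dotv u (a *: v) = a * dotv u v.
Proof. by rewrite dotvC dotvZl dotvC. Qed.

Lemma dotvNl u v : dotv (- u) v = - dotv u v.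
Proof. by rewrite -scaleN1r dotvZl mulN1r. Qed.

Lemma dotvNr u v : dotv u (- v) = - dotv u v.
Proof. by rewrite dotvC dotvNl dotvC. Qed.

Lemma dotvv_eq0 u : (dotv u u == 0) = (u == 0).
Proof.
apply/eqP/eqP => [u0|->]; last by rewrite /dotv mul0mx mxE.
apply/rowP => i; rewrite mxE; apply/eqP; rewrite -sqrf_eq0 expr2.
apply/eqP; move: u0; rewrite dotvE => /psumr_eq0P -> // j _.
by rewrite -expr2 sqr_ge0.
Qed.

Lemma dotvv_gt0 u : (0 < dotv u u) = (u != 0).
Proof. by rewrite lt0r dotvv_ge0 andbT dotvv_eq0. Qed.

Lemma dotv_mulmx n (M : 'M[R]_(m, n)) u (x : 'rV_n) :
  dotv (u *m M) x = dotv u (x *m M^T).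
Proof. by rewrite /dotv trmx_mul trmxK mulmxA. Qed.

End DotProduct.

(** * Spectral theorem and simultaneous diagonalization of two forms *)

Section Spectral.
Context {R : realType}.

(** The characteristic polynomial has a complex root [z], with eigenvector [re + i im]. Comparing
    [re T . im] with [re . im T] gives Im z (|re|^2 + |im|^2) = 0, so [z] is real and whichever of
    [re], [im] is nonzero is an eigenvector. *)
Lemma real_sym_eigenvector n (T : 'M[R]_n.+1) : T^T = T ->
  exists a, exists2 v : 'rV_n.+1, v != 0 & v *m T = a *: v.
Proof.
move=> Tsym; pose TC := map_mx (real_complex R) T.
have [z] : exists z, root (char_poly TC) z.
  by apply/closed_rootP; rewrite size_char_poly.
rewrite -eigenvalue_root_char => /eigenvalueP[w wT w0].
pose re := map_mx (@complex.Re R) w; pose im := map_mx (@complex.Im R) w.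
have reT : re *m T = complex.Re z *: re - complex.Im z *: im.
  apply/rowP => j; have /rowP/(_ j)/(congr1 (@complex.Re R)) := wT.
  rewrite !mxE => zw.
  have -> : complex.Re z * complex.Re (w 0 j) - complex.Im z * complex.Im (w 0 j)
    = complex.Re (z * w 0 j) by case: (z) (w 0 j) => ? ? [].
  rewrite -zw raddf_sum /=; apply: eq_bigr => i _; rewrite !mxE.
  by case: (w 0 i) => x y /=; rewrite mulr0 subr0.
have imT : im *m T = complex.Re z *: im + complex.Im z *: re.
  apply/rowP => j; have /rowP/(_ j)/(congr1 (@complex.Im R)) := wT.
  rewrite !mxE => zw.
  have -> : complex.Re z * complex.Im (w 0 j) + complex.Im z * complex.Re (w 0 j)
    = complex.Im (z * w 0 j).
    by case: (z) (w 0 j) => ? ? [? ?] /=; rewrite [X in _ + X]mulrC.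
  rewrite -zw raddf_sum /=; apply: eq_bigr => i _; rewrite !mxE.
  by case: (w 0 i) => x y /=; rewrite mulr0 add0r.
have z_real : complex.Im z = 0.
  have : dotv (re *m T) im = dotv re (im *m T) by rewrite dotv_mulmx Tsym.
  rewrite reT imT dotvDl dotvDr -scaleNr !dotvZl !dotvZr => /eqP.
  rewrite -subr_eq0 opprD addrACA subrr add0r mulNr -opprD oppr_eq0.
  rewrite -mulrDr mulf_eq0 => /orP[/eqP //|].
  rewrite paddr_eq0 ?dotvv_ge0 // !dotvv_eq0 => /andP[/eqP im0 /eqP re0].
  case/eqP: w0; apply/rowP => i.
  move/rowP/(_ i): im0; move/rowP/(_ i): re0; rewrite !mxE.
  by case: (w 0 i) => x y /= -> ->.
exists (complex.Re z).
have [re0|re0] := eqVneq re 0; last first.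
  by exists re => //; rewrite reT z_real scale0r subr0.
exists im; last by rewrite imT z_real scale0r addr0.
apply: contra w0 => /eqP im0; apply/eqP/rowP => i.
move/rowP/(_ i): im0; move/rowP/(_ i): re0; rewrite !mxE.
by case: (w 0 i) => x y /= -> ->.
Qed.

(** Because X^2 = |u|^2 X, products of such matrices reduce to scalar arithmetic. This serves the
    Householder reflection, the inverse square root of the metric and its inverse. *)
Lemma mul_rank_one_update n (u : 'rV[R]_n) k l (X := u^T *m u) :
  (1%:M + k *: X) *m (1%:M + l *: X) = 1%:M + (k + l + k * l * dotv u u) *: X.
Proof.
have uuT : u *m u^T = (dotv u u)%:M.
  by apply/matrixP => i j; rewrite !ord1 [RHS]mxE eqxx mulr1n.
have XX : X *m X = dotv u u *: X.
  by rewrite mulmxA -(mulmxA u^T) uuT mul_mx_scalar -scalemxAl.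
rewrite mulmxDl mul1mx mulmxDr mulmx1 -scalemxAl -scalemxAr XX !scalerA.
by rewrite [k + l]addrC !scalerDl !addrA.
Qed.

Lemma tr_rank_one_update n (u : 'rV[R]_n) k :
  (1%:M + k *: (u^T *m u))^T = 1%:M + k *: (u^T *m u).
Proof. by rewrite raddfD /= linearZ /= trmx1 trmx_mul trmxK. Qed.

(* A Householder reflection moves the first basis vector to [v]. *)
Lemma orthogonal_completion n (v : 'rV[R]_n.+1) : dotv v v = 1 ->
  exists Q : 'M[R]_n.+1, Q *m Q^T = 1%:M /\ row 0 Q = v.
Proof.
move=> v1; pose e : 'rV[R]_n.+1 := delta_mx 0 0.
have [->|ve] := eqVneq v e.
  by exists 1%:M; rewrite trmx1 mulmx1 rowE mulmx1.
pose w := v - e; pose c := 2 / dotv w w.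
have w0 : dotv w w != 0 by rewrite dotvv_eq0 subr_eq0.
exists (1%:M + (- c) *: (w^T *m w)); split.
  rewrite tr_rank_one_update mul_rank_one_update.
  have -> : - c - c + - c * - c * dotv w w = 0 by rewrite /c; field.
  by rewrite scale0r addr0.
rewrite rowE mulmxDr mulmx1 -scalemxAr mulmxA.
have -> : delta_mx 0 0 *m w^T = (dotv e w)%:M.
  by apply/matrixP => i j; rewrite !ord1 [RHS]mxE eqxx mulr1n.
rewrite mul_scalar_mx scalerA.
have -> : - c * dotv e w = 1.
  have e1 : dotv e e = 1 by rewrite /dotv trmx_delta mul_delta_mx mxE.
  apply: (mulIf w0); rewrite mulrAC mulNr /c divfK //.
  rewrite /w !dotvDl !dotvNl !dotvDr !dotvNr e1 v1 (dotvC v).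
  by ring.
by rewrite scale1r addrC subrK.
Qed.

(** Deflation: a unit eigenvector completed to an orthogonal matrix [Q] makes [Q T Q^T] block
    diagonal, with an eigenvalue and a smaller symmetric block. *)
Lemma real_spectral n (T : 'M[R]_n) : T^T = T ->
  exists (P : 'M[R]_n) (d : 'rV[R]_n), P *m P^T = 1%:M /\ P *m T *m P^T = diag_mx d.
Proof.
elim: n T => [|n IHn] T Tsym; first by
  exists 0, 0; split; apply: etrans (flatmx0 _) _; rewrite [RHS]flatmx0.
have [a [v v0 vT]] := real_sym_eigenvector Tsym.
pose u := (enorm v)^-1 *: v.
have u1 : dotv u u = 1.
  rewrite dotvZl dotvZr mulrA -expr2 exprVn sqr_sqrtr ?dotvv_ge0 // mulVf //.
  by rewrite dotvv_eq0.
have uT : u *m T = a *: u by rewrite -scalemxAl vT scalerA mulrC -scalerA.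
have [Q [QQ Qu]] := orthogonal_completion u1.
pose S : 'M[R]_(1 + n) := Q *m T *m Q^T.
have Ssym : S^T = S by rewrite /S !trmx_mul trmxK Tsym mulmxA.
have S0 : row 0 S = a *: delta_mx 0 0.
  by rewrite /S !row_mul Qu uT -scalemxAl -Qu -row_mul QQ row1.
have Si0 i : S i 0 = a *+ (i == 0).
  have -> : S i 0 = row 0 S 0 i by rewrite -[in LHS]Ssym !mxE.
  by rewrite S0 !mxE eqxx mulr_natr.
(* The index 0 is restated as [lshift n 0], the form in which it occurs in entries of block
   matrices. *)
have {}Si0 (i : 'I_(1 + n)) :
    S i (lshift n (0 : 'I_1)) = a *+ (i == lshift n (0 : 'I_1)).
  have -> : lshift n (0 : 'I_1) = (0 : 'I_n.+1) by exact: val_inj.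
  exact: Si0.
have SE : S = block_mx a%:M 0 0 (drsubmx S).
  clearbody S; rewrite -[LHS]submxK.
  congr block_mx; apply/matrixP => i j; rewrite !mxE ?ord1.
  - by rewrite Si0 eqxx.
  - by rewrite -{1}Ssym mxE Si0 eq_rlshift.
  - by rewrite Si0 eq_rlshift.
have [|P [d [PP PS]]] := IHn (drsubmx S).
  by rewrite trmx_drsub Ssym.
pose P1 : 'M[R]_(1 + n) := block_mx 1%:M 0 0 P.
have P1P1 : P1 *m P1^T = 1%:M.
  rewrite /P1 tr_block_mx mulmx_block !trmx0 !trmx1 PP.
  by rewrite !(mulmx0, mul0mx, mulmx1, addr0, add0r) scalar_mx_block.
have P1S : P1 *m S *m P1^T = diag_mx (row_mx a%:M d).
  rewrite SE /P1 tr_block_mx !mulmx_block !trmx0 !trmx1.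
  rewrite !(mulmx0, mul0mx, mulmx1, mul1mx, addr0, add0r) PS.
  by rewrite diag_mx_row; congr block_mx; apply/matrixP => i j; rewrite !mxE !ord1.
exists ((P1 : 'M[R]_n.+1) *m Q), (row_mx a%:M d); split.
  by rewrite trmx_mul mulmxA -(mulmxA _ Q) QQ mulmx1.
by rewrite trmx_mul mulmxA -(mulmxA _ Q T) -(mulmxA _ _ Q^T).
Qed.

(* With [W = sqrt (1 + |p|^2)], the matrix [1 + p^T p] is the square of
   [1 + p^T p / (W + 1)], whose inverse is [1 - p^T p / (W (W + 1))]. *)
Lemma simultaneous_diagonalization n (p : 'rV[R]_n) (H : 'M[R]_n) : H^T = H ->
  exists (B : 'M[R]_n) (d : 'rV[R]_n),
    B *m (1%:M + p^T *m p) *m B^T = 1%:M /\ B *m H *m B^T = diag_mx d.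
Proof.
move=> Hsym; pose W := Num.sqrt (1 + dotv p p); pose X := p^T *m p.
have W2 : W * W = 1 + dotv p p.
  by rewrite -expr2 sqr_sqrtr // addr_ge0 ?dotvv_ge0.
have W0 : 0 < W by rewrite sqrtr_gt0 ltr_pwDl ?dotvv_ge0.
pose C k : 'M[R]_n := 1%:M + k *: X.
have CC k l : C k *m C l = C (k + l + k * l * (W * W - 1)).
  rewrite /C mul_rank_one_update; congr (_ + _ *: _).
  by rewrite W2; ring.
pose D := C (- (W * (W + 1))^-1).
have [|P [d [PP PD]]] := @real_spectral _ (D *m H *m D).
  by rewrite !trmx_mul !tr_rank_one_update Hsym mulmxA.
exists (P *m D), d; split; last first.
  by rewrite trmx_mul tr_rank_one_update !mulmxA in PD *.
have -> : 1%:M + X = C 1 by rewrite /C scale1r.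
rewrite trmx_mul tr_rank_one_update !mulmxA -(mulmxA P) CC -(mulmxA P) CC.
set k := (X in C X); have -> : k = 0.
  rewrite /k; field.
  by rewrite !gt_eqF // ltr_wpDl // ltW.
by rewrite /C scale0r addr0 mulmx1.
Qed.
End Spectral.

(** * Second differences and the symmetry of mixed derivatives *)

Section LineDerivative.
Context {R : realType} {V : normedModType R}.
Implicit Types (f : V -> R) (x v w : V).

Lemma is_derive_line f x v (t : R) : (forall y, differentiable f y) ->
  is_derive t 1 (fun s : R => f (x + s *: v)) ('D_v f (x + t *: v)).
Proof.
move=> df.
have E : (fun h : R => h^-1 *: (((fun s : R => f (x + s *: v)) \o shift t) h%:A
    - f (x + t *: v))) = (fun h : R => h^-1 *: ((f \o shift (x + t *: v)) (h *: v)
    - f (x + t *: v))).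
  apply/funext => h /=; congr (_ *: (f _ - _)).
  by rewrite [h%:A]mulr1 scalerDl addrCA addrA addrC.
apply: DeriveDef; last by rewrite /derive E.
by rewrite /derivable E; apply: diff_derivable.
Qed.

(* Two mean value theorems, one along [v] and one along [w]. *)
Lemma second_difference_mean f v w x s :
  (forall y, differentiable f y) -> (forall y, differentiable ('D_v f) y) ->
  0 < s -> exists a b, [/\ 0 <= a <= s, 0 <= b <= s &
    f (x + s *: v + s *: w) - f (x + s *: v) - f (x + s *: w) + f x =
    s ^+ 2 * 'D_w ('D_v f) (x + a *: v + b *: w)].
Proof.
move=> df ddf s0.
pose phi (t : R) := f (x + s *: w + t *: v) - f (x + t *: v).
pose dphi t := 'D_v f (x + s *: w + t *: v) - 'D_v f (x + t *: v).
have [t _| |a a_s aE] := @MVT R phi dphi 0 s s0.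
- by apply: is_deriveB; apply: is_derive_line.
- apply: derivable_within_continuous => t _.
  by apply: derivableB; apply: (@ex_derive _ _ _ _ _ _ _ (is_derive_line _ _ _ df)).
have [t _| |b b_s bE] := @MVT R (fun t => 'D_v f (x + a *: v + t *: w))
  (fun t => 'D_w ('D_v f) (x + a *: v + t *: w)) 0 s s0.
- exact: is_derive_line.
- apply: derivable_within_continuous => t _.
  by apply: (@ex_derive _ _ _ _ _ _ _ (is_derive_line _ _ _ ddf)).
exists a, b; split.
- by move: a_s; rewrite in_itv /= => /andP[/ltW -> /ltW].
- by move: b_s; rewrite in_itv /= => /andP[/ltW -> /ltW].
move: aE bE; rewrite /phi /dphi !scale0r !addr0 subr0 (addrAC x _ (a *: v)) => aE bE.
rewrite [RHS](_ : _ = 'D_w ('D_v f) (x + a *: v + b *: w) * s * s); last by ring.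
by rewrite -bE -aE (addrAC x (s *: w)); ring.
Qed.

End LineDerivative.

Lemma eq_of_common_approx {R : realType} (a b : R) :
  (forall e, 0 < e -> exists c, `|a - c| < e /\ `|b - c| < e) -> a = b.
Proof.
move=> ab; apply/eqP; rewrite -subr_eq0 -normr_le0; apply/ler_addgt0Pl => e e0.
have [|c [ac bc]] := ab (e / 2); first by rewrite divr_gt0.
rewrite addr0 (splitr e) (le_trans (ler_distD c _ _)) //.
by rewrite lerD ?ltW // distrC.
Qed.

Section Schwarz.
Context {R : realType} {V : normedModType R}.
Variables (f : V -> R) (v w : V).
Hypotheses (df : forall y, differentiable f y)
  (dvf : forall y, differentiable ('D_v f) y)
  (dwf : forall y, differentiable ('D_w f) y)
  (cvw : continuous ('D_w ('D_v f))) (cwv : continuous ('D_v ('D_w f))).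

(** The second difference [Delta] is symmetric in [v] and [w]. Divided by s^2 it is a value of
    either mixed derivative at a point near [x], so by continuity it approximates both values at
    [x]. *)
Lemma schwarz x : 'D_w ('D_v f) x = 'D_v ('D_w f) x.
Proof.
apply: eq_of_common_approx => e e0.
have /cvgrPdist_lt/(_ _ e0)/nbhs_ballP[d1 d1_0 B1] := @cvw x.
have /cvgrPdist_lt/(_ _ e0)/nbhs_ballP[d2 d2_0 B2] := @cwv x.
pose d := Num.min d1 d2.
have d_gt0 : 0 < d by rewrite lt_min d1_0.
(* With this step size every a v + b w with a, b in [0, s] is shorter than [d]; the summand 1 covers
   v = w = 0. *)
pose s := d / (`|v| + `|w| + 1).
have N0 : 0 < `|v| + `|w| + 1 by rewrite ltr_wpDl ?addr_ge0.
have s0 : 0 < s by rewrite divr_gt0.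
have near_x a b : 0 <= a <= s -> 0 <= b <= s ->
    `|x - (x + a *: v + b *: w)| < d.
  move=> /andP[a0 as_] /andP[b0 bs].
  rewrite -addrA opprD addrA subrr add0r normrN.
  apply: le_lt_trans (ler_normD _ _) _; rewrite !normrZ !ger0_norm //.
  apply: (@le_lt_trans _ _ (s * `|v| + s * `|w|)).
    by rewrite lerD // ler_wpM2r.
  have -> : d = s * `|v| + s * `|w| + s by rewrite /s; field; rewrite gt_eqF.
  by rewrite ltrDl.
pose Delta := f (x + s *: v + s *: w) - f (x + s *: v) - f (x + s *: w) + f x.
have [A E1 H1] : exists2 A, Delta = s ^+ 2 * A & `|'D_w ('D_v f) x - A| < e.
  have [a [b [aI bI E1]]] := second_difference_mean w x df dvf s0.
  exists ('D_w ('D_v f) (x + a *: v + b *: w)); first exact: E1.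
  apply: B1; rewrite -ball_normE /=.
  by apply: lt_le_trans (near_x _ _ aI bI) _; rewrite ge_min lexx.
have [B E2 H2] : exists2 B, Delta = s ^+ 2 * B & `|'D_v ('D_w f) x - B| < e.
  have [a [b [aI bI E2]]] := second_difference_mean v x df dwf s0.
  exists ('D_v ('D_w f) (x + a *: w + b *: v)).
    by rewrite -E2 /Delta (addrAC x (s *: v)); congr (_ + _); apply: addrAC.
  apply: B2; rewrite -ball_normE /= (addrAC x).
  by apply: lt_le_trans (near_x _ _ bI aI) _; rewrite ge_min lexx orbT.
have AB : A = B.
  by apply: (@mulfI _ (s ^+ 2)); rewrite ?sqrf_eq0 ?gt_eqF // -E1.
exists A; split; first exact: H1.
rewrite AB; exact: H2.
Qed.

End Schwarz.

(** * Gradient and Hessian of a C^2 function *)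

Section Hessian.
Context {R : realType} {n : nat}.
Implicit Types (f : 'rV[R]_n -> R) (x v w : 'rV[R]_n).

Definition grad f x : 'rV[R]_n := \row_i 'D_(delta_mx 0 i) f x.

Definition hessian f x : 'M[R]_n :=
  \matrix_(i, j) 'D_(delta_mx 0 i) ('D_(delta_mx 0 j) f) x.

Lemma derive_grad f x v : differentiable f x -> 'D_v f x = dotv v (grad f x).
Proof.
move=> df; rewrite deriveE // dotvE [in LHS](row_sum_delta v) linear_sum.
by apply: eq_bigr => i _; rewrite linearZ mxE deriveE.
Qed.

Lemma derive2_hessian f x v w : of_class_C 2 f ->
  'D_v ('D_w f) x = dotv (v *m hessian f x) w.
Proof.
move=> [df ddf].
have -> : 'D_w f = \sum_j (w 0 j \*: 'D_(delta_mx 0 j) f).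
  apply/funext => y; rewrite derive_grad // dotvE fct_sumE.
  by apply: eq_bigr => j _; rewrite mxE.
have dD j y u : derivable ('D_(delta_mx 0 j) f) y u.
  by apply: diff_derivable; have [] := ddf (delta_mx 0 j).
rewrite derive_sum => [|j]; last exact: derivableZ.
rewrite dotvE; apply: eq_bigr => j _; rewrite deriveZ // derive_grad.
  rewrite mulrC; congr (_ * _); rewrite dotvE mxE.
  by apply: eq_bigr => i _; rewrite !mxE.
by have [] := ddf (delta_mx 0 j).
Qed.

Lemma hessian_sym f x : of_class_C 2 f -> (hessian f x)^T = hessian f x.
Proof.
move=> [df ddf]; apply/matrixP => i j; rewrite !mxE.
have [di ci] := ddf (delta_mx 0 i); have [dj cj] := ddf (delta_mx 0 j).
exact: (schwarz df di dj (ci _) (cj _)).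
Qed.

End Hessian.

(** * The second derivative test at a maximum *)

Section SecondOrder.
Context {R : realType}.

(** Here [psi] is phi' near 0 and [k] is phi''(0). If [k] were positive, [psi] would be positive
    just to the right of 0, and the mean value theorem on [0, s] would give phi s > phi 0. *)
Lemma second_derivative_le0 (phi psi : R -> R) (k : R) :
  (\forall t \near (0 : R), is_derive (t : R) 1 phi (psi t)) ->
  is_derive (0 : R) 1 psi k ->
  (\forall t \near (0 : R), phi t <= phi 0) -> psi 0 = 0 /\ k <= 0.
Proof.
move=> dphi [psi_der psi_val] phi_max.
have /nbhs_ballP[d d0 dP] : \forall t \near (0 : R),
    is_derive (t : R) 1 phi (psi t) /\ phi t <= phi 0 by exact: filterI.
have {}d0 : 0 < d := d0.
have dD (t : R) : `|t| < d -> is_derive t 1 phi (psi t).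
  by move=> td; apply: (dP t _).1; rewrite -ball_normE /= sub0r normrN.
have dM (t : R) : `|t| < d -> phi t <= phi 0.
  by move=> td; apply: (dP t _).2; rewrite -ball_normE /= sub0r normrN.
have psi0 : psi 0 = 0.
  have E : 'D_1 phi 0 = 0.
    apply: derive_val; apply: (@derive1_at_max _ _ (- d) d 0).
    - by rewrite (@ge0_cp _ d) // ltW.
    - move=> t; rewrite in_itv /= -ltr_norml => /dD dt; exact: ex_derive.
    - by rewrite in_itv /= oppr_lt0 d0.
    - by move=> t; rewrite in_itv /= -ltr_norml => /dM.
  have dd : is_derive (0 : R) 1 phi (psi 0) by apply: dD; rewrite normr0.
  by have := @derive_val _ _ _ _ _ _ _ dd; rewrite E => <-; exact: erefl.
split; first exact: psi0.
rewrite leNgt; apply/negP => k0.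
have : \forall h \near 0^', 0 < h^-1 *: (psi (h + 0) - psi 0).
  have cv : h^-1 *: ((psi \o shift 0) h%:A - psi 0) @[h --> 0^'] --> k.
    by rewrite -psi_val.
  apply: filterS (cvgr_gt k cv 0 k0) => h.
  by rewrite /= [h%:A]mulr1.
case/nbhs_ballP => /= d' d'0 d'P.
pose s := Num.min d d' / 2.
have m0 : 0 < Num.min d d' by rewrite lt_min d0 d'0.
have s0 : 0 < s by rewrite divr_gt0.
have [sd sd'] : s < d /\ s < d'.
  have : s < Num.min d d' by rewrite /s; lra.
  by rewrite lt_min => /andP[].
have [t| |c] := @MVT _ phi psi 0 s s0.
- rewrite in_itv /= => /andP[t0 ts]; apply: dD.
  by rewrite gtr0_norm // (lt_trans ts).
- apply: derivable_within_continuous => t; rewrite in_itv /= => /andP[t0 ts].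
  suff dt : is_derive t 1 phi (psi t) by exact: ex_derive.
  by apply: dD; rewrite ger0_norm // (le_lt_trans ts).
rewrite in_itv /= => /andP[c0 cs] E.
have : phi s <= phi 0 by apply: dM; rewrite gtr0_norm.
rewrite -subr_le0 E subr0; apply/negP; rewrite -ltNge mulr_gt0 //.
have := d'P c; rewrite /= addr0 psi0 subr0 /ball /= sub0r normrN.
rewrite gtr0_norm // (lt_trans cs) // => /(_ isT).
rewrite gt_eqF // => /(_ isT); rewrite /GRing.scale /=.
by rewrite pmulr_rgt0 // invr_gt0.
Qed.
End SecondOrder.

(** * Maximum of a function minus a barrier on a ball *)

Section Barrier.
Context {R : realType} {n : nat}.
Implicit Types (f : 'rV[R]_n -> R) (x y v : 'rV[R]_n).

Lemma continuous_dotvv : continuous (fun x => dotv x x).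
Proof.
have -> : (fun x : 'rV[R]_n => dotv x x) = fun x => \sum_i x 0 i * x 0 i.
  by apply/funext => y; rewrite dotvE.
apply: continuous_big => [|i _ x]; first exact: add_continuous.
have cx := (@coord_continuous R 1 n 0 i x).
exact: (continuousM cx cx).
Qed.

Lemma compact_ball (a : R) : compact [set x : 'rV[R]_n | dotv x x <= a].
Proof.
apply: bounded_closed_compact; last first.
  apply: (@preimage_closed _ _ (fun x => dotv x x) [set t | t <= a]).
    by move=> x _; exact: continuous_dotvv.
  exact: closed_le.
exists (a + 1); split; first exact: num_real.
move=> M aM x /= xa; rewrite /Num.norm /= mx_normrE.
apply/bigmax_leP; split=> [|[i j] _ /=].
  by apply: le_trans (ltW aM); rewrite addr_ge0 // (le_trans (dotvv_ge0 x)).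
have xj : x i j ^+ 2 <= a.
  apply: le_trans xa; rewrite dotvE (bigD1 j) //= (ord1 i) expr2 lerDl.
  by rewrite sumr_ge0 // => k _; rewrite -expr2 sqr_ge0.
apply: le_trans (ltW aM); rewrite -subr_ge0.
(* This gives 2z <= z^2 + 1 <= a + 1 for each entry [z] in absolute value, a bound in the sup norm
   that needs no square root of [a]. *)
have : 0 <= (`|x i j| - 1) ^+ 2 by rewrite sqr_ge0.
have : `|x i j| ^+ 2 <= a by rewrite real_normK ?num_real.
have := normr_ge0 (x i j).
set z := `|x i j|; nra.
Qed.

(** The barrier blows up at the boundary of the ball, so a maximum over a slightly smaller closed
    ball is a maximum over the open one. *)
Lemma barrier_max f (a c : R) : continuous f -> 0 < a -> 0 < c ->
  exists2 x, dotv x x < a & forall y, dotv y y < a ->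
    f y - c / (a - dotv y y) <= f x - c / (a - dotv x x).
Proof.
move=> cf a0 c0.
have q0 : dotv (0 : 'rV[R]_n) 0 = 0 by rewrite /dotv mul0mx mxE.
have [||z _ zmax] := @EVT_max_rV _ _ f _ _ (@compact_ball a).
- by exists 0 => /=; rewrite q0 ltW.
- exact: continuous_subspaceT.
have {}zmax y : dotv y y <= a -> f y <= f z by move=> ya; apply: zmax; rewrite inE.
have fz0 : f 0 <= f z by apply: zmax; rewrite q0 ltW.
(* Where a - |y|^2 < c / M the barrier is at least [M], so the difference is at most f z - M = f 0 -
   c / a - 1, less than its value at the centre. *)
pose M := f z - f 0 + c / a + 1.
have ca0 : 0 < c / a by rewrite divr_gt0.
have M0 : 0 < M by rewrite /M; lra.
have cM : c / M < a.
  rewrite ltr_pdivrMr // mulrC -ltr_pdivrMr // /M; lra.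
pose g y := f y - c / (a - dotv y y).
have [||x /[!inE] /= xK xmax] := @EVT_max_rV _ _ g _ _ (@compact_ball (a - c / M)).
- by exists 0 => /=; rewrite q0 subr_ge0 ltW.
- apply: (@continuous_in_subspaceT _ _ _ g) => y /[!inE] /= yK.
  have cM0 : 0 < c / M by rewrite divr_gt0.
  apply: (@continuousB _ _ _ f _ y (@cf y)).
  apply: (@continuousM _ _ (cst c) (fun z => (a - dotv z z)^-1)).
    exact: cst_continuous.
  apply: (@continuousV _ _ (fun z => a - dotv z z)).
    by rewrite gt_eqF //; lra.
  apply: (@continuousB _ _ _ (cst a) _ y); first exact: cst_continuous.
  exact: continuous_dotvv.
have cM0 : 0 < c / M by rewrite divr_gt0.
have {}xmax y : dotv y y <= a - c / M -> g y <= g x.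
  by move=> ya; apply: xmax; rewrite inE.
exists x => [|y ya]; first lra.
have [yK|yK] := leP (dotv y y) (a - c / M); first exact: xmax.
apply: le_trans (xmax 0 _); last by rewrite q0; lra.
rewrite /g q0 subr0.
have : M <= c / (a - dotv y y).
  rewrite ler_pdivlMr ?subr_gt0 // mulrC -ler_pdivlMr //; lra.
have := zmax y (ltW ya); rewrite /M; lra.
Qed.
End Barrier.

(** * Comparison with the barrier at the touching point *)

Section Touching.
Context {R : realType}.

Lemma is_derive_inv_poly (r s : {poly R}) (t : R) : r.[t] != 0 ->
  is_derive t 1 (fun u => s.[u] / r.[u])
    (s^`().[t] / r.[t] - s.[t] * r^`().[t] / r.[t] ^+ 2).
Proof.
move=> r0; have dr := is_deriveV r0 (is_derive_poly r t).
have ds := is_derive_poly s t.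
apply: (@is_derive_eq _ _ _ _ _ _ _ _ (is_deriveM ds dr)).
rewrite /GRing.scale /=; field; exact: r0.
Qed.

(** [u'] and [u''] are the derivatives of q |-> c / (a - q) at q = |x|^2. On the line x + t v the
    barrier is c / r(t) with [r] a quadratic polynomial, and the second derivative test applies at t
    = 0. *)
Lemma touching_hessian n (f : 'rV[R]_n -> R) (a c : R) (x v : 'rV[R]_n) :
  of_class_C 2 f -> dotv x x < a ->
  (forall y, dotv y y < a -> f y - c / (a - dotv y y) <= f x - c / (a - dotv x x)) ->
  let u' := c / (a - dotv x x) ^+ 2 in
  let u'' := 2 * c / (a - dotv x x) ^+ 3 in
  'D_v f x = 2 * u' * dotv v x /\
  'D_v ('D_v f) x <= 4 * u'' * dotv v x ^+ 2 + 2 * u' * dotv v v.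
Proof.
move=> [df ddf] xa xmax u' u''.
have [dvf _] := ddf v.
pose r : {poly R} :=
  (a - dotv x x)%:P - (2 * dotv v x)%:P * 'X - (dotv v v)%:P * 'X^2.
have rE t : r.[t] = a - dotv (x + t *: v) (x + t *: v).
  rewrite /r !hornerE !(dotvDl, dotvDr, dotvZl, dotvZr) (dotvC x v) /=.
  by ring.
have r'E t : r^`().[t] = - 2 * dotv v (x + t *: v).
  rewrite /r !poly.derivE !hornerE /= dotvDr dotvZr; ring.
have r0E : r.[0] = a - dotv x x by rewrite rE scale0r addr0.
have r'0E : r^`().[0] = - 2 * dotv v x by rewrite r'E scale0r addr0.
have r''E : r^`()^`().[0] = - 2 * dotv v v.
  rewrite /r !poly.derivE !hornerE /=; ring.
clearbody r.
have r0 : 0 < r.[0] by rewrite r0E subr_gt0.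
pose phi t := f (x + t *: v) - c%:P.[t] / r.[t].
pose psi t := 'D_v f (x + t *: v) - (- c *: r^`()).[t] / (r * r).[t].
have r_near : \forall t \near (0 : R), 0 < r.[t].
  have /cvgr_gt := @continuous_horner _ r 0.
  exact.
have dphi : \forall t \near (0 : R), is_derive (t : R) 1 phi (psi t).
  apply: filterS r_near => t rt.
  have rt0 : r.[t] != 0 by rewrite gt_eqF.
  have d1 := is_derive_line x v t df.
  have d2 := is_derive_inv_poly c%:P rt0.
  apply: (@is_derive_eq _ _ _ _ _ _ _ _ (is_deriveB d1 d2)).
  rewrite /psi derivC !hornerE; congr (_ - _).
  by field.
have dpsi : is_derive (0 : R) 1 psi ('D_v ('D_v f) x -
    (4 * u'' * dotv v x ^+ 2 + 2 * u' * dotv v v)).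
  have rt0 : (r * r).[0] != 0 by rewrite hornerM mulf_neq0 ?gt_eqF.
  have d1 := is_derive_line x v 0 dvf.
  have d2 := is_derive_inv_poly (- c *: r^`()) rt0.
  apply: (@is_derive_eq _ _ _ _ _ _ _ _ (is_deriveB d1 d2)).
  rewrite scale0r addr0; congr (_ - _).
  set K := RHS; rewrite derivZ derivM !hornerE r''E r'0E r0E /K /u' /u''.
  field; by rewrite -r0E gt_eqF.
have phi_max : \forall t \near (0 : R), phi t <= phi 0.
  apply: filterS r_near => t rt.
  rewrite /phi !hornerE r0E scale0r addr0 rE; apply: xmax.
  by rewrite -subr_gt0 -rE.
have [psi0 k0] := second_derivative_le0 dphi dpsi phi_max.
split; last by rewrite -subr_le0.
move: psi0; rewrite /psi scale0r addr0 => /eqP; rewrite subr_eq0 => /eqP ->.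
by set K := RHS; rewrite !hornerE r'0E r0E /K /u'; field; rewrite -r0E gt_eqF.
Qed.

(* The curvatures of the graph of [12 / e^3 / (6 / e^2 - |x|^2)], the
   barrier of [small_curvature_point], are at most [e]. *)
Lemma barrier_curvature (e q : R) : 0 < e -> 0 <= q -> q < 6 / e ^+ 2 ->
  let D := 6 / e ^+ 2 - q in let c := 12 / e ^+ 3 in
  let k := 2 * (c / D ^+ 2) in let W := Num.sqrt (1 + k ^+ 2 * q) in
  k <= e * W /\ 4 * (2 * c / D ^+ 3) <= e * W * k ^+ 2.
Proof.
move=> e0 q0 qa D c k W.
have D0 : 0 < D by rewrite subr_gt0.
have e_neq0 : e != 0 by rewrite gt_eqF.
have D_neq0 : D != 0 by rewrite gt_eqF.
have k0 : 0 < k by rewrite !mulr_gt0 // ?invr_gt0 exprn_gt0.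
have [e_ge0 k_ge0] : 0 <= e /\ 0 <= k by rewrite !ltW.
have kq0 : 0 <= k ^+ 2 * q by rewrite mulr_ge0 // sqr_ge0.
have W2 : W ^+ 2 = 1 + k ^+ 2 * q by rewrite sqr_sqrtr // addr_ge0.
have W0 : 0 <= W by exact: sqrtr_ge0.
have W1 : 1 <= W.
  by rewrite -(@ler_pXn2r _ 2) ?nnegrE // W2 expr1n lerDl.
have e2D : e ^+ 2 * D = 6 - e ^+ 2 * q by rewrite /D; field.
have e2q0 : 0 <= e ^+ 2 * q by rewrite mulr_ge0 // sqr_ge0.
split.
  (* If e^2 q >= 1, then (e W)^2 = e^2 + e^2 q k^2 >= k^2. Otherwise e^2 D > 5, and k = 24 e / (e^2
     D)^2 is less than [e], while W >= 1. *)
  have [eq1|eq1] := leP 1 (e ^+ 2 * q).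
    rewrite -(@ler_pXn2r _ 2) ?nnegrE ?(mulr_ge0 e_ge0 W0) //.
    rewrite [(e * W) ^+ 2]exprMn W2 mulrDr mulr1.
    rewrite -[leLHS]add0r lerD ?sqr_ge0 //.
    by rewrite mulrCA ler_peMr ?sqr_ge0.
  apply: (@le_trans _ _ e); last by rewrite ler_peMr.
  have kE : k * (e ^+ 2 * D) ^+ 2 = 24 * e by rewrite /k /c; field; rewrite D_neq0.
  have : 25 <= (e ^+ 2 * D) ^+ 2.
    rewrite (_ : 25 = 5 ^+ 2); last by ring.
    by rewrite ler_pXn2r ?nnegrE // e2D; lra.
  move: kE; set z := (_ ^+ 2) => kE z25.
  rewrite -(@ler_pM2r _ z); last lra.
  rewrite kE; have : e * 25 <= e * z by rewrite ler_pM2l.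
  move: e0; clear; lra.
(* The quotient of e k^2 by the left side is e c / (2 D). It is at least 1 since e^3 c = 12 and e^2
   D = 6 - e^2 q <= 6; this is what ties the constants 12 and 6 together. *)
apply: (@le_trans _ _ (e * k ^+ 2)); last first.
  by rewrite mulrAC ler_peMr // mulr_ge0 ?sqr_ge0 // ltW.
have -> : e * k ^+ 2 = 4 * (2 * c / D ^+ 3) * (e * c / (2 * D)).
  by rewrite /k /c; field; rewrite D_neq0.
have c_ge0 : 0 <= c by rewrite divr_ge0 // exprn_ge0.
apply: ler_peMr; first by rewrite !mulr_ge0 // invr_ge0 exprn_ge0 // ltW.
rewrite ler_pdivlMr ?mulr_gt0 // mul1r.
rewrite -(@ler_pM2l _ (e ^+ 2)) ?exprn_gt0 // mulrCA e2D.
have -> : e ^+ 2 * (e * c) = 12 by rewrite /c; field.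
lra.
Qed.

(** After division by the square root, the left side is the second fundamental form for the upward
    normal; the last factor is the first fundamental form. So all curvatures at [x] are at most [e].
    The point is where f minus the barrier is maximal, and there the two gradients agree. *)
Lemma small_curvature_point n (f : 'rV[R]_n -> R) (e : R) :
  of_class_C 2 f -> 0 < e -> exists x, forall v,
    'D_v ('D_v f) x <= e * Num.sqrt (1 + dotv (grad f x) (grad f x)) *
                       (dotv v v + dotv v (grad f x) ^+ 2).
Proof.
move=> fC2 e0.
have cf : continuous f by move=> y; apply: differentiable_continuous; exact: fC2.1.
have a0 : 0 < 6 / e ^+ 2 by rewrite divr_gt0 // exprn_gt0.
have c0 : 0 < 12 / e ^+ 3 by rewrite divr_gt0 // exprn_gt0.
have [x xa xmax] := barrier_max cf a0 c0.
exists x => v.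
have [_ Dvv] := touching_hessian v fC2 xa xmax.
have gradE : grad f x = (2 * (12 / e ^+ 3 / (6 / e ^+ 2 - dotv x x) ^+ 2)) *: x.
  apply/rowP => i; rewrite mxE [RHS]mxE.
  have [-> _] := touching_hessian (delta_mx 0 i) fC2 xa xmax.
  by congr (_ * _); rewrite /dotv -rowE !mxE.
apply: le_trans Dvv _; rewrite gradE !(dotvZl, dotvZr).
have [q0 b2 d0] : [/\ 0 <= dotv x x, 0 <= dotv v x ^+ 2 & 0 <= dotv v v].
  by rewrite !dotvv_ge0 sqr_ge0.
have [] := barrier_curvature e0 q0 xa.
move: b2 d0; clear; move: (dotv x x) (dotv v x) (dotv v v) => q b d b2 d0.
set k := 2 * _; rewrite [k * (k * q)]mulrA -expr2; set W := Num.sqrt _ => kW uW.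
rewrite exprMn (addrC d) mulrDr [e * W * (k ^+ 2 * _)]mulrA.
by apply: lerD; exact: ler_wpM2r.
Qed.

End Touching.

(** * Jacobians by coordinates and a scalar chain rule *)

Section Jacobian.
Context {R : realType} {n m : nat}.
Implicit Types (F : 'rV[R]_n -> 'rV[R]_m) (x v : 'rV[R]_n).

Lemma differentiable_rV F x :
  (forall j, differentiable (fun y => F y 0 j) x) -> differentiable F x.
Proof.
move=> dF; have -> : F = \sum_j (fun y => F y 0 j *: delta_mx 0 j).
  by apply/funext => y; rewrite fct_sumE; exact: row_sum_delta.
by apply: differentiable_sum => j; apply: differentiableZl.
Qed.

Lemma jacobianE F x i j : (forall k, differentiable (fun y => F y 0 k) x) ->
  'J F x i j = 'D_(delta_mx 0 i) (fun y => F y 0 j) x.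
Proof.
move=> /differentiable_rV dF.
have entry (A : 'M[R]_(n, m)) : A i j = ((delta_mx 0 i : 'rV[R]_n) *m A) 0 j.
  by rewrite -rowE mxE.
rewrite entry.
rewrite -deriveEjacobian // derive_mx ?mxE //.
exact: diff_derivable.
Qed.

End Jacobian.

Lemma derive_coord {R : realType} {n : nat} (x v : 'rV[R]_n) j :
  'D_v (fun y : 'rV[R]_n => y 0 j) x = v 0 j.
Proof.
have /(congr1 (fun u : 'rV[R]_n => u 0 j)) := derive_id x v.
by rewrite derive_mx; [rewrite mxE | exact: derivable_id].
Qed.

Section ScalarChainRule.
Context {R : realType} {V : normedModType R}.

Lemma differentiable_comp_scalar (h : R -> R) (g : V -> R) (x : V) (h' : R) :
  differentiable g x -> is_derive (g x) 1 h h' -> differentiable (h \o g) x.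
Proof.
move=> dg [dh _]; apply: differentiable_comp => //.
exact/derivable1_diffP.
Qed.

Lemma derive_comp_scalar (h : R -> R) (g : V -> R) (x v : V) (h' : R) :
  differentiable g x -> is_derive (g x) 1 h h' ->
  'D_v (h \o g) x = 'D_v g x * h'.
Proof.
move=> dg dh; have dh' : differentiable h (g x) by apply/derivable1_diffP; case: dh.
have dhg := differentiable_comp_scalar dg dh.
rewrite deriveE // diff_comp //= deriveE //.
have <- : 'd h (g x) 1 = h' by rewrite -deriveE //; case: dh.
by rewrite -[in LHS](mulr1 ('d g x v)) linearZ.
Qed.

Lemma is_derive_invsqrt (s : R) : 0 < s ->
  is_derive s 1 (fun t => (Num.sqrt t)^-1) (- (2 * Num.sqrt s ^+ 3)^-1).
Proof.
move=> s0; have r0 : Num.sqrt s != 0 by rewrite gt_eqF // sqrtr_gt0.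
apply: (@is_derive_eq _ _ _ _ _ _ _ _ (is_deriveV r0 (is_derive1_sqrt s0))).
by rewrite /GRing.scale /=; field.
Qed.
End ScalarChainRule.

(** * Unit normal and Weingarten map of a graph *)

Section GraphGeometry.
Context {R : realType} {n : nat}.
Variables (f : 'rV[R]_n -> R) (N : 'rV[R]_(n + 1) -> 'rV[R]_(n + 1)).
Hypotheses (fC2 : of_class_C 2 f) (N_normal : unit_normal_field f N).
Implicit Types x v : 'rV[R]_n.

Let df x : differentiable f x.
Proof. exact: fC2.1. Qed.

Let ddf v x : differentiable ('D_v f) x.
Proof. exact: (fC2.2 v).1. Qed.

(** The area density W of the graph, not the length of the gradient. *)
Definition slope x := Num.sqrt (1 + dotv (grad f x) (grad f x)).

Lemma slope_sqr x : slope x ^+ 2 = 1 + dotv (grad f x) (grad f x).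
Proof. by rewrite sqr_sqrtr // addr_ge0 ?dotvv_ge0. Qed.

Lemma slope_gt0 x : 0 < slope x.
Proof. by rewrite sqrtr_gt0 ltr_pwDl ?dotvv_ge0. Qed.

Lemma lsubmx_chart x : lsubmx (chart f x) = x.
Proof. by rewrite row_mxKl. Qed.

Lemma differentiable_chart_coord x k :
  differentiable (fun y => chart f y 0 k) x.
Proof.
case: (split_ordP k) => i ->.
  have -> : (fun y => chart f y 0 (lshift 1 i)) = fun y => y 0 i.
    by apply/funext => y; rewrite row_mxEl.
  exact: differentiable_coord.
have -> : (fun y => chart f y 0 (rshift n i)) = f.
  by apply/funext => y; rewrite row_mxEr ord1 mxE.
exact: df.
Qed.

Lemma tangent_basisE x : tangent_basis f (chart f x) = row_mx 1%:M (grad f x)^T.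
Proof.
rewrite /tangent_basis lsubmx_chart; apply/matrixP => i k.
rewrite jacobianE; last exact: differentiable_chart_coord.
case: (split_ordP k) => j ->.
  have -> : (fun y => chart f y 0 (lshift 1 j)) = fun y => y 0 j.
    by apply/funext => y; rewrite row_mxEl.
  by rewrite row_mxEl derive_coord !mxE eqxx eq_sym.
have -> : (fun y => chart f y 0 (rshift n j)) = f.
  by apply/funext => y; rewrite row_mxEr ord1 mxE.
by rewrite row_mxEr !mxE.
Qed.

Lemma graph_chart x : graph f (chart f x).
Proof. by exists x. Qed.

(** [N] is continuous only relative to the graph; this suffices because [chart] takes its values
    there. *)
Lemma continuous_normal_chart : continuous (fun x => N (chart f x)).
Proof.
move=> x; have [cN _] := N_normal.
have Nx := (subspace_continuousP _ _).1 cN _ (graph_chart x).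
have cc : continuous (chart f).
  move=> y; have dc : differentiable (chart f) y.
    exact: (differentiable_rV (@differentiable_chart_coord y)).
  exact: (differentiable_continuous dc).
move=> P /Nx NP.
have Pgraph : \forall y \near x, graph f (chart f y) -> P (N (chart f y)).
  exact: (@cc x _ NP).
have Pchart : \forall y \near x, P (N (chart f y)).
  by apply: filterS Pgraph => y; apply; exact: graph_chart.
exact: Pchart.
Qed.

(** Orthogonality to the i-th coordinate vector determines the i-th entry of [N] from its last entry
    [a]; unit length then determines a^2. *)
Lemma normal_coords x (a := N (chart f x) 0 (rshift n 0)) :
  N (chart f x) = a *: row_mx (- grad f x) 1%:M /\ a ^+ 2 * slope x ^+ 2 = 1.
Proof.
have [_ /(_ _ (graph_chart x))[N1 N_orth]] := N_normal.
have NE : N (chart f x) = a *: row_mx (- grad f x) 1%:M.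
  apply/rowP => k; rewrite mxE; case: (split_ordP k) => i ->; last first.
    by rewrite row_mxEr ord1 mxE mulr1.
  rewrite row_mxEl mxE.
  have := N_orth (row i (tangent_basis f (chart f x))) (row_sub _ _).
  rewrite tangent_basisE dotvE big_split_ord /= big_ord1.
  rewrite [row _ _ _ (rshift _ _)]mxE row_mxEr !mxE -/a.
  rewrite (bigD1 i) //= big1 => [|j ji].
    rewrite [row _ _ _ _]mxE row_mxEl mxE eqxx mul1r addr0 mulrN => /eqP.
    by rewrite addr_eq0 mulrC => /eqP.
  by rewrite [row _ _ _ _]mxE row_mxEl mxE eq_sym (negbTE ji) mul0r.
split=> //; move: N1; rewrite /enorm => /(congr1 (fun t => t ^+ 2)).
rewrite sqr_sqrtr ?dotvv_ge0 // expr1n NE dotvZl dotvZr mulrA -expr2 => <-.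
congr (_ * _); rewrite slope_sqr /dotv tr_row_mx mul_row_col.
by rewrite linearN /= mulNmx mulmxN opprK mxE addrC tr_scalar_mx mulmx1 !mxE eqxx.
Qed.

(** The last entry of [N] is continuous and never zero, so by the intermediate value theorem on the
    segment from 0 to [x] its sign is the same everywhere. The sign [s] tells the upward normal from
    the downward one. *)
Lemma normal_chart : exists2 s, s ^+ 2 = 1 &
  forall x, N (chart f x) = (s / slope x) *: row_mx (- grad f x) 1%:M.
Proof.
pose a x := N (chart f x) 0 (rshift n 0).
have a2 x : a x ^+ 2 * slope x ^+ 2 = 1 by have [] := normal_coords x.
have a0 x : a x != 0.
  by apply: contra_eq_neq (a2 x) => ->; rewrite expr0n mul0r eq_sym oner_neq0.
have ca : continuous a.
  move=> x; have c1 := @continuous_normal_chart x.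
  apply: (@continuous_comp _ _ _ (fun x => N (chart f x))
    (fun M => M 0 (rshift n 0))).
    exact: c1.
  exact: coord_continuous.
have same_sign x : 0 < a 0 * a x.
  rewrite lt0r mulf_neq0 //= leNgt; apply/negP => ax.
  have cat : {within `[0, 1], continuous (fun t : R => a (t *: x))}.
    have sc : continuous (fun t : R => t *: x) by exact: scalel_continuous.
    apply: continuous_subspaceT => t.
    exact: (@continuous_comp R _ _ (fun t : R => t *: x) a t (@sc t) (@ca _)).
  have [|t _ at0] := @IVT _ (fun t : R => a (t *: x)) 0 1 0 ler01 cat.
    rewrite scale0r scale1r ge_min le_max; move: ax; rewrite mulr_lt0.
    by case: (ltgtP (a 0) 0); case: (ltgtP (a x) 0) => //; rewrite ?andbF.
  by have := a0 (t *: x); rewrite at0 eqxx.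
exists (Num.sg (a 0)); first by rewrite sqr_sg a0.
move=> x; have [-> _] := normal_coords x; congr (_ *: _); rewrite -/(a x).
have sl := slope_gt0 x.
have -> : Num.sg (a 0) = Num.sg (a x).
  have := same_sign x; have [a0_lt|a0_gt|a0_eq] := ltgtP (a 0) 0.
  - by rewrite nmulr_rgt0 // => ax; rewrite !ltr0_sg.
  - by rewrite pmulr_rgt0 // => ax; rewrite !gtr0_sg.
  - by rewrite a0_eq mul0r ltxx.
have absW : `|a x| * slope x = 1.
  apply/eqP; rewrite -(@eqrXn2 _ 2) ?ler01 //; last by rewrite mulr_ge0 // ltW.
  by rewrite exprMn real_normK ?num_real // a2 expr1n.
have -> : slope x = `|a x|^-1.
  by apply: (mulfI (_ : `|a x| != 0)); rewrite ?absW ?divff // normr_eq0.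
by rewrite invrK -numEsg.
Qed.

Let sq_gradE : (fun y => 1 + dotv (grad f y) (grad f y)) =
  cst 1 + \sum_(k < n) ('D_(delta_mx 0 k) f * 'D_(delta_mx 0 k) f).
Proof.
apply/funext => y; rewrite dotvE /= fctE /= fct_sumE; congr (_ + _).
by apply: eq_bigr => k _; rewrite mxE.
Qed.

Lemma differentiable_sq_grad x :
  differentiable (fun y => 1 + dotv (grad f y) (grad f y)) x.
Proof.
rewrite sq_gradE; apply: differentiableD; first exact: differentiable_cst.
apply: differentiable_sum => k; apply: differentiableM; exact: ddf.
Qed.

Lemma derive_sq_grad x v :
  'D_v (fun y => 1 + dotv (grad f y) (grad f y)) x =
  2 * dotv (v *m hessian f x) (grad f x).
Proof.
rewrite sq_gradE.
have dk (k : 'I_n) : derivable ('D_(delta_mx 0 k) f) x v.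
  by apply: diff_derivable; exact: ddf.
have dkk (k : 'I_n) : derivable ('D_(delta_mx 0 k) f * 'D_(delta_mx 0 k) f) x v.
  exact: derivableM.
rewrite deriveD; [|exact: derivable_cst|exact: derivable_sum].
rewrite derive_cst add0r derive_sum // dotvE mulr_sumr; apply: eq_bigr => k _.
rewrite deriveM // derive2_hessian // /GRing.scale /= [grad _ _ _ _]mxE.
have -> : dotv (v *m hessian f x) (delta_mx 0 k) = (v *m hessian f x) 0 k.
  by rewrite dotvC /dotv -rowE !mxE.
by ring.
Qed.

Lemma is_derive_inv_slope x : is_derive (1 + dotv (grad f x) (grad f x)) 1
  (fun t : R => (Num.sqrt t)^-1) (- (2 * slope x ^+ 3)^-1).
Proof. by apply: is_derive_invsqrt; rewrite ltr_pwDl ?dotvv_ge0. Qed.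

Lemma differentiable_inv_slope x : differentiable (fun y => (slope y)^-1) x.
Proof.
exact: (differentiable_comp_scalar
  (differentiable_sq_grad x) (is_derive_inv_slope x)).
Qed.

Lemma derive_inv_slope x v :
  'D_v (fun y => (slope y)^-1) x =
  - dotv (v *m hessian f x) (grad f x) / slope x ^+ 3.
Proof.
have := derive_comp_scalar v (differentiable_sq_grad x) (is_derive_inv_slope x).
rewrite derive_sq_grad => E; apply: etrans E _.
by field; rewrite gt_eqF // slope_gt0.
Qed.

(** The matrix of the shape operator for the upward normal in the coordinate basis: Hessian over W,
    times the inverse of the metric 1 + p^T p with p the gradient. *)
Definition weingarten x : 'M[R]_n := (slope x)^-1 *:
  (hessian f x *m (1%:M + (- slope x ^- 2) *: ((grad f x)^T *m grad f x))).

(** Since p p^T = W^2 - 1, the inverse metric sends p^T to W^-2 p^T, which gives the last column. *)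
Lemma weingarten_tangent x :
  weingarten x *m row_mx 1%:M (grad f x)^T =
  (slope x)^-1 *: row_mx
    (hessian f x *m (1%:M + (- slope x ^- 2) *: ((grad f x)^T *m grad f x)))
    (slope x ^- 2 *: (hessian f x *m (grad f x)^T)).
Proof.
rewrite /weingarten -scalemxAl mul_mx_row mulmx1; congr (_ *: row_mx _ _).
rewrite -mulmxA mulmxDl mul1mx -scalemxAl -mulmxA.
have -> : grad f x *m (grad f x)^T = (slope x ^+ 2 - 1)%:M.
  apply/matrixP => i j; rewrite !ord1 [RHS]mxE eqxx mulr1n slope_sqr.
  by rewrite addrC addKr.
have sl : slope x != 0 by rewrite gt_eqF // slope_gt0.
rewrite mul_mx_scalar scalerA -[X in X + _]scale1r -scalerDl -scalemxAr.
by congr (_ *: _); field.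
Qed.

(** The Weingarten equation dN = - A, checked by coordinates: those of [N] are - s D_j f / W and,
    last, s / W. *)
Lemma jacobian_normal x s :
  (forall y, N (chart f y) = (s / slope y) *: row_mx (- grad f y) 1%:M) ->
  'J (N \o chart f) x = - s *: (weingarten x *m tangent_basis f (chart f x)).
Proof.
move=> NE; rewrite tangent_basisE weingarten_tangent.
have Nl (j : 'I_n) : (fun y => (N \o chart f) y 0 (lshift 1 j)) =
    (- s) \*: ((fun y => (slope y)^-1) * 'D_(delta_mx 0 j) f).
  apply/funext => y; rewrite /= NE mxE row_mxEl !mxE /GRing.scale /= fctE /=.
  by ring.
have Nr (j : 'I_1) : (fun y => (N \o chart f) y 0 (rshift n j)) =
    s \*: (fun y => (slope y)^-1).
  by apply/funext => y; rewrite /= NE mxE row_mxEr ord1 mxE mulr1.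
have dw := differentiable_inv_slope x.
apply/matrixP => i k; rewrite jacobianE => [|{}k]; last first.
  case: (split_ordP k) => j ->.
    by rewrite Nl; apply: differentiableZ; apply: differentiableM => //; exact: ddf.
  by rewrite Nr; apply: differentiableZ.
have rowH : (delta_mx 0 i : 'rV[R]_n) *m hessian f x = row i (hessian f x).
  by rewrite -rowE.
have dotH : dotv (row i (hessian f x)) (grad f x) =
    (hessian f x *m (grad f x)^T) i 0.
  by rewrite /dotv -row_mul mxE.
have sl : slope x != 0 by rewrite gt_eqF // slope_gt0.
case: (split_ordP k) => j ->.
  have dj := ddf (delta_mx 0 j) x.
  rewrite Nl deriveZ; last by apply: derivableM; exact: diff_derivable.
  rewrite deriveM; [|exact: diff_derivable|exact: diff_derivable].
  rewrite derive_inv_slope rowH dotH.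
  rewrite [RHS]mxE [X in _ = _ * X]mxE row_mxEl mulmxDr mulmx1 -scalemxAr mulmxA.
  have entry (A : 'M[R]_n) (u : 'cV[R]_n) (v : 'rV[R]_n) c :
      (A + c *: (u *m v)) i j = A i j + c * (u i 0 * v 0 j).
    by rewrite !mxE big_ord1.
  rewrite entry [hessian f x i j]mxE [grad f x 0 j]mxE /GRing.scale /=.
  by field.
rewrite Nr deriveZ; last exact: diff_derivable.
rewrite derive_inv_slope rowH dotH.
have entryZ (b : R) (u : 'cV[R]_n) : (b *: u) i 0 = b * u i 0 by rewrite mxE.
rewrite [RHS]mxE [X in _ = _ * X]mxE row_mxEr ord1 entryZ /GRing.scale /=.
by move: ((hessian f x *m _) i 0) => h; field.
Qed.

End GraphGeometry.

(** * Principal curvatures and Ricci curvature in a principal frame *)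

Lemma char_poly_intertwine {F : fieldType} n (A D B : 'M[F]_n) :
  B \in unitmx -> B *m A = D *m B -> char_poly A = char_poly D.
Proof.
move=> Bunit BA; rewrite /char_poly; pose BX := map_mx (@polyC F) B.
have BX0 : \det BX != 0.
  by rewrite det_map_mx polyC_eq0 -unitfE -unitmxE.
apply: (mulfI BX0); rewrite -det_mulmx mulrC -det_mulmx; congr (\det _).
rewrite /char_poly_mx mulmxBr mulmxBl -!map_mxM BA.
by rewrite mul_mx_scalar mul_scalar_mx.
Qed.

Section CurvatureFrame.
Context {R : realType} {n : nat}.
Variables (f : 'rV[R]_n -> R) (N : 'rV[R]_(n + 1) -> 'rV[R]_(n + 1)).
Hypotheses (n_gt1 : (1 < n)%N) (fC2 : of_class_C 2 f)
  (N_normal : unit_normal_field f N).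
Implicit Types x u : 'rV[R]_n.

Let n_gt0 : (0 < n)%N.
Proof. exact: ltnW. Qed.

Lemma row_free_tangent_basis x : row_free (tangent_basis f (chart f x)).
Proof.
apply/row_freeP; exists (col_mx 1%:M 0).
by rewrite tangent_basisE // mul_row_col mulmx1 mulmx0 addr0.
Qed.

Lemma shape_tangent x s u :
  (forall y, N (chart f y) = (s / slope f y) *: row_mx (- grad f y) 1%:M) ->
  Defs.shape f N (chart f x) (u *m tangent_basis f (chart f x)) =
  s *: (u *m weingarten f x *m tangent_basis f (chart f x)).
Proof.
move=> NE; rewrite /Defs.shape mulmxKp ?row_free_tangent_basis // lsubmx_chart.
by rewrite (jacobian_normal fC2 x NE) scaleNr mulmxN opprK -scalemxAr mulmxA.
Qed.

Lemma shape_mxE x s :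
  (forall y, N (chart f y) = (s / slope f y) *: row_mx (- grad f y) 1%:M) ->
  shape_mx f N (chart f x) = s *: weingarten f x.
Proof.
move=> NE; apply/row_matrixP => i; rewrite rowK rowE.
rewrite (shape_tangent _ _ NE) -scalemxAl mulmxKp ?row_free_tangent_basis //.
by rewrite -rowE; apply/rowP => j; rewrite !mxE.
Qed.

(** Sorting the given roots shows that [xget] does not return its default; the sum is then read off
    the coefficient of degree n - 1 of the characteristic polynomial. *)
Lemma sum_principal_curvatures x (k : 'rV[R]_n) :
  char_poly (shape_mx f N (chart f x)) = \prod_i ('X - (k 0 i)%:P) ->
  \sum_(c <- principal_curvatures f N (chart f x)) c =
  \tr (shape_mx f N (chart f x)).
Proof.
move=> kE; set T := shape_mx f N (chart f x) in kE *.
pose K := [set l : n.-tuple R | sorted <=%R l /\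
  char_poly T = \prod_(c <- l) ('X - c%:P)].
have : K (principal_curvatures f N (chart f x)).
  rewrite /principal_curvatures -/T -/K; apply: xgetPex.
  have sz : size (sort <=%R [seq k 0 i | i <- enum 'I_n]) == n.
    by rewrite size_sort size_map size_enum_ord.
  exists (Tuple sz); split; first by apply: sort_sorted; exact: le_total.
  rewrite kE /= (perm_big _ (permEl (perm_sort _ _))) /= big_map.
  by rewrite -big_enum.
case=> _ TE; set l := principal_curvatures _ _ _ in TE *.
have szl : size l = n by rewrite size_tuple.
apply: oppr_inj; rewrite -char_poly_trace // TE.
by have := @coefPn_prod_XsubC _ l; rewrite szl -lt0n => ->.
Qed.

(** The rows of [B] are the chart coordinates of an orthonormal principal frame, and [k] holds the
    curvatures for the upward normal. [normA] and [Ric] are even in the shape operator, so the sign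
    [s] of the given normal drops out through s^2 = 1. *)
Lemma curvature_frame x : negative_Ricci f N ->
  exists (B : 'M[R]_n) (k : 'rV[R]_n),
  [/\ B *m (1%:M + (grad f x)^T *m grad f x) *m B^T = 1%:M,
      B *m hessian f x *m B^T = slope f x *: diag_mx k,
      normA f N (chart f x) = Num.sqrt (\sum_i k 0 i ^+ 2) &
      forall i, k 0 i * (\sum_j k 0 j - k 0 i) < 0].
Proof.
move=> Ric_lt0; have [s s2 NE] := normal_chart fC2 N_normal.
have sl : slope f x != 0 by rewrite gt_eqF // slope_gt0.
have [B [d [Bg BH]]] := simultaneous_diagonalization (grad f x) (hessian_sym x fC2).
pose k := (slope f x)^-1 *: d.
set g := _ + _ in Bg; set p := grad f x in g Bg *; set H := hessian f x in BH *.
pose G := 1%:M + (- slope f x ^- 2) *: (p^T *m p).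
have gG : g *m G = 1%:M.
  rewrite /g -[p^T *m p]scale1r mul_rank_one_update.
  rewrite (_ : 1 - _ + _ = 0) ?scale0r ?addr0 //.
  have -> : dotv p p = slope f x ^+ 2 - 1 by rewrite slope_sqr addrC addKr.
  by field.
(* B g B^T = 1 makes B^T B the inverse metric, so [B] intertwines the Weingarten matrix with
   [diag_mx k]. *)
have BBT : B^T *m B = G.
  have : g *m (B^T *m B) = 1%:M.
    by rewrite mulmxA; apply: mulmx1C; rewrite mulmxA.
  by move=> E; rewrite -[LHS]mul1mx -(mulmx1C gG) -mulmxA E mulmx1.
have Bunit : B \in unitmx.
  by have [] := mulmx1_unit (etrans (mulmxA _ _ _) Bg).
have dE : diag_mx d = slope f x *: diag_mx k.
  by rewrite /k linearZ /= scalerA divff // scale1r.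
have BS : B *m weingarten f x = diag_mx k *m B.
  rewrite /weingarten -/H -/p -/G -BBT -scalemxAr !mulmxA BH dE.
  by rewrite -scalemxAl scalerA mulVf // scale1r.
pose T := shape_mx f N (chart f x).
have TE : T = s *: weingarten f x by exact: shape_mxE.
have BT : B *m T = diag_mx (s *: k) *m B.
  by rewrite TE -scalemxAr BS scalemxAl -linearZ.
have trT : \tr T = s * \sum_i k 0 i.
  have -> : T = invmx B *m (diag_mx (s *: k) *m B) by rewrite -BT mulKmx.
  rewrite mxtrace_mulC mulmxK // mxtrace_diag mulr_sumr.
  by apply: eq_bigr => i _; rewrite mxE.
have sumT : \sum_(c <- principal_curvatures f N (chart f x)) c = s * \sum_i k 0 i.
  rewrite -trT; apply: (@sum_principal_curvatures _ (s *: k)).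
  rewrite (char_poly_intertwine Bunit BT) char_poly_trig ?diag_mx_is_trig //.
  by apply: eq_bigr => i _; rewrite !mxE eqxx mulr1n.
exists B, k; split=> //; first by rewrite BH.
  rewrite /normA -/T; congr (Num.sqrt _).
  have -> : T *m T = invmx B *m (diag_mx (s *: k) *m diag_mx (s *: k) *m B).
    rewrite -[diag_mx _ *m diag_mx _ *m B]mulmxA -BT.
    by rewrite [diag_mx _ *m (B *m T)]mulmxA -BT -mulmxA mulKmx.
  rewrite mxtrace_mulC mulmxK // mulmx_diag mxtrace_diag.
  by apply: eq_bigr => i _; rewrite !mxE mulrACA -!expr2 s2 mul1r.
move=> i; pose v := row i B *m tangent_basis f (chart f x).
have vv : dotv v v = 1.
  have JJ : tangent_basis f (chart f x) *m (tangent_basis f (chart f x))^T = g.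
    rewrite tangent_basisE // tr_row_mx mul_row_col trmxK trmx1 mulmx1.
    by rewrite /g /p.
  rewrite /v /dotv trmx_mul mulmxA -(mulmxA (row i B)) JJ.
  have -> : (row i B *m g *m (row i B)^T) 0 0 = (B *m g *m B^T) i i.
    rewrite -row_mul [LHS]mxE [RHS]mxE; apply: eq_bigr => j _.
    by rewrite [row _ _ _ _]mxE [_^T j 0]mxE [row _ _ _ _]mxE [B^T j i]mxE.
  by rewrite Bg mxE eqxx.
have Av : Defs.shape f N (chart f x) v = (s * k 0 i) *: v.
  rewrite /v (shape_tangent _ _ NE) -row_mul BS.
  have -> : row i (diag_mx k *m B) = k 0 i *: row i B.
    by apply/rowP => j; rewrite mul_diag_mx !mxE.
  by rewrite -scalemxAl scalerA.
have v1 : enorm v = 1 by rewrite /enorm vv sqrtr1.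
have tv : tangent f (chart f x) v by exact: submxMl.
have := Ric_lt0 _ _ (graph_chart f x) tv v1.
rewrite /Ric ltr_pdivrMr; last by rewrite subr_gt0 ltr1n.
rewrite mul0r /mean_curvature sumT mulVKf ?pnatr_eq0 -?lt0n // Av.
rewrite /enorm sqr_sqrtr ?dotvv_ge0 // !dotvZl dotvZr vv.
rewrite [X in X < 0](_ : _ = s ^+ 2 * (k 0 i * (\sum_j k 0 j - k 0 i))).
  by rewrite s2 mul1r.
by ring.
Qed.
End CurvatureFrame.

(** * Quadratic forms, negative planes and positive hyperplanes *)

Section QuadraticForms.
Context {R : realType} {n : nat}.
Implicit Types (H E : 'M[R]_n) (w b : 'rV[R]_n).

Definition qform H w := dotv (w *m H) w.

Lemma qformE H w : qform H w = \sum_i \sum_j w 0 i * w 0 j * H i j.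
Proof.
rewrite /qform dotvE exchange_big /=; apply: eq_bigr => j _.
by rewrite mxE mulr_suml; apply: eq_bigr => i _; rewrite mulrAC.
Qed.

Lemma qformB H H' w : qform (H - H') w = qform H w - qform H' w.
Proof. by rewrite /qform mulmxBr dotvDl dotvNl. Qed.

Lemma qform_diag (k : 'rV[R]_n) w :
  qform (diag_mx k) w = \sum_i k 0 i * w 0 i ^+ 2.
Proof.
rewrite /qform dotvE; apply: eq_bigr => i _.
by rewrite mul_mx_diag mxE; ring.
Qed.

Lemma qform_mul H (B : 'M[R]_n) w : qform H (w *m B) = qform (B *m H *m B^T) w.
Proof. by rewrite /qform dotvC dotv_mulmx dotvC !mulmxA. Qed.

(** Each |w_i w_j| is at most (w_i^2 + w_j^2) / 2, and these sum to n |w|^2. *)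
Lemma qform_bound E (e : R) w : (forall i j, `|E i j| <= e) ->
  `|qform E w| <= n%:R * e * dotv w w.
Proof.
move=> Ee; rewrite qformE.
apply: le_trans (ler_norm_sum _ _ _) _.
have -> : n%:R * e * dotv w w =
    \sum_i \sum_(j < n) (e / 2 * w 0 i ^+ 2 + e / 2 * w 0 j ^+ 2).
  have dE : dotv w w = \sum_i w 0 i ^+ 2.
    by rewrite dotvE; apply: eq_bigr => i _; rewrite expr2.
  have -> : \sum_i \sum_(j < n) (e / 2 * w 0 i ^+ 2 + e / 2 * w 0 j ^+ 2) =
      \sum_(i < n) (n%:R * (e / 2) * w 0 i ^+ 2 + e / 2 * dotv w w).
    apply: eq_bigr => i _; rewrite big_split /= sumr_const card_ord dE mulr_sumr.
    by congr (_ + _); rewrite -[LHS]mulr_natl mulrA.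
  rewrite big_split /= -mulr_sumr -dE sumr_const card_ord -mulr_natl.
  by field.
apply: ler_sum => i _; apply: le_trans (ler_norm_sum _ _ _) _.
apply: ler_sum => j _; rewrite normrM normrM.
apply: (@le_trans _ _ (`|w 0 i| * `|w 0 j| * e)).
  by rewrite ler_wpM2l // mulr_ge0.
have e0 : 0 <= e by apply: le_trans (Ee i j).
have : 0 <= (`|w 0 i| - `|w 0 j|) ^+ 2 by rewrite sqr_ge0.
rewrite -(real_normK (num_real (w 0 i))) -(real_normK (num_real (w 0 j))).
move: `|w 0 i| `|w 0 j| => x y; move: e0; clear => e0 xy.
have : 0 <= e * (x - y) ^+ 2 by rewrite mulr_ge0.
rewrite [e * (x - y) ^+ 2](_ : _ = e * (x ^+ 2 + y ^+ 2) - 2 * (x * y * e));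
  last by ring.
lra.
Qed.

(** The uniform constant [c] makes stability under small perturbations of [H] immediate, without
    compactness of the unit sphere. *)
Definition negative_plane H := exists b1 b2 (c : R), [/\ 0 < c,
  (forall s t : R, s *: b1 + t *: b2 = 0 -> s = 0 /\ t = 0) &
  forall (s t : R) (w := s *: b1 + t *: b2), qform H w <= - c * dotv w w].

(** The hyperplane is the kernel of [l]; l = 0 is allowed and means positive definite on the whole
    space. *)
Definition positive_hyperplane H := exists (l : 'cV[R]_n) (c : R),
  0 < c /\ forall w, w *m l = 0 -> c * dotv w w <= qform H w.

(** A plane meets the kernel of a linear form in a nonzero vector, on which the two inequalities
    contradict each other. *)
Lemma negative_plane_positive_hyperplane H :
  negative_plane H -> positive_hyperplane H -> False.
Proof.
move=> [b1 [b2 [c [c0 free12 neg12]]]] [l [d [d0 pos]]].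
suff [s [t [st wl]]] : exists s t,
    ~ (s = 0 /\ t = 0) /\ (s *: b1 + t *: b2) *m l = 0.
  set w := s *: b1 + t *: b2 in wl.
  have w0 : 0 < dotv w w.
    rewrite dotvv_gt0; apply/eqP => w0; apply: st; exact: free12.
  have := le_trans (pos _ wl) (neg12 s t); rewrite -/w ler_pM2r //.
  by move: c0 d0; clear; lra.
pose l1 := (b1 *m l) 0 0; pose l2 := (b2 *m l) 0 0.
have lE s t : (s *: b1 + t *: b2) *m l = (s * l1 + t * l2)%:M.
  apply/matrixP => i j; rewrite !ord1 mulmxDl -!scalemxAl [RHS]mxE eqxx mulr1n.
  by rewrite [LHS]mxE; congr (_ + _); rewrite mxE.
have [l10|l10] := eqVneq l1 0.
  exists 1, 0; split; first by case=> /eqP; rewrite oner_eq0.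
  by rewrite lE l10 mulr0 mul0r addr0 raddf0.
exists l2, (- l1); split.
  by case=> _ /eqP; rewrite oppr_eq0 (negbTE l10).
by rewrite lE mulNr mulrC subrr raddf0.
Qed.

Lemma qform_frame H (B : 'M[R]_n) (k : 'rV[R]_n) (W : R) w :
  B *m H *m B^T = W *: diag_mx k ->
  qform H (w *m B) = W * \sum_i k 0 i * w 0 i ^+ 2.
Proof.
by move=> BH; rewrite qform_mul BH -qform_diag /qform -scalemxAr dotvZl.
Qed.

Section Frame.
Variables (H B : 'M[R]_n) (p k : 'rV[R]_n) (W : R).
Hypotheses (W0 : 0 < W) (Bg : B *m (1%:M + p^T *m p) *m B^T = 1%:M)
  (BH : B *m H *m B^T = W *: diag_mx k).

Lemma frame_unit : B \in unitmx.
Proof. by have [] := mulmx1_unit (etrans (mulmxA _ _ _) Bg). Qed.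

Lemma frame_metric w : dotv (w *m B) (w *m B) + dotv (w *m B) p ^+ 2 = dotv w w.
Proof.
have -> : dotv w w = qform (1%:M + p^T *m p) (w *m B).
  by rewrite qform_mul Bg /qform mulmx1.
rewrite /qform mulmxDr mulmx1 dotvDl; congr (_ + _).
rewrite mulmxA (_ : _ *m p^T = (dotv (w *m B) p)%:M).
  by rewrite mul_scalar_mx dotvZl (dotvC p) expr2.
by apply/matrixP => i j; rewrite !ord1 [RHS]mxE eqxx mulr1n.
Qed.

(** Passes from the norm of frame coordinates, which is the metric norm, to the Euclidean norm used
    by [negative_plane] and [positive_hyperplane]. *)
Lemma frame_norm_le w : dotv (w *m B) (w *m B) <= dotv w w.
Proof. by rewrite -[leRHS]frame_metric lerDl sqr_ge0. Qed.

Lemma frame_negative_plane i j : i != j -> k 0 i < 0 -> k 0 j < 0 ->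
  negative_plane H.
Proof.
move=> ij ki kj; pose c := W * Num.min (- k 0 i) (- k 0 j).
pose u s t : 'rV[R]_n := s *: delta_mx 0 i + t *: delta_mx 0 j.
have uB s t : s *: row i B + t *: row j B = u s t *m B.
  by rewrite !rowE mulmxDl -!scalemxAl.
have ui s t : u s t 0 i = s.
  by rewrite !mxE !eqxx (negbTE ij) /= mulr1 mulr0 addr0.
have uj s t : u s t 0 j = t.
  by rewrite !mxE !eqxx [j == i]eq_sym (negbTE ij) /= mulr1 mulr0 add0r.
have u0 s t l : l != i -> l != j -> u s t 0 l = 0.
  by move=> /negbTE li /negbTE lj; rewrite !mxE li lj !andbF !mulr0 addr0.
have sum2 s t (F : 'I_n -> R) :
    \sum_l F l * u s t 0 l ^+ 2 = F i * s ^+ 2 + F j * t ^+ 2.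
  rewrite (bigD1 i) //= (bigD1 j) 1?eq_sym //= ui uj.
  rewrite big1 ?addr0 // => l /andP[li lj].
  by rewrite u0 // expr0n mulr0.
have c0 : 0 < c by rewrite mulr_gt0 // lt_min !oppr_gt0 ki.
exists (row i B), (row j B), c; split=> // [s t|s t].
  rewrite uB => /(congr1 (mulmx^~ (invmx B))); rewrite mulmxK ?frame_unit // mul0mx.
  move=> /rowP u_0; split.
    by rewrite -(ui s t) u_0 mxE.
  by rewrite -(uj s t) u_0 mxE.
rewrite /= uB (qform_frame _ BH) sum2.
apply: (@le_trans _ _ (- c * dotv (u s t) (u s t))).
  have -> : dotv (u s t) (u s t) = s ^+ 2 + t ^+ 2.
    rewrite dotvE -[RHS](_ : 1 * s ^+ 2 + 1 * t ^+ 2 = _); last by rewrite !mul1r.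
    by rewrite -(sum2 s t (fun=> 1)); apply: eq_bigr => l _; rewrite mul1r expr2.
  rewrite /c -mulrN -mulrA ler_pM2l // mulrDr lerD // ler_wpM2r ?sqr_ge0 //.
    by rewrite lerNr ge_min lexx.
  by rewrite lerNr ge_min lexx orbT.
by rewrite !mulNr lerN2 ler_pM2l // frame_norm_le.
Qed.

Lemma frame_positive_hyperplane i : (forall j, j != i -> 0 < k 0 j) ->
  positive_hyperplane H.
Proof.
(* The default 1 keeps [c] positive when there is no other index. *)
move=> kpos; pose c := \big[Num.min/1]_(j | j != i) k 0 j.
have c0 : 0 < c by apply/bigmin_gtP; split.
have ck j : j != i -> c <= k 0 j by move=> ji; apply: bigmin_le_cond.
(* This column computes the i-th frame coordinate, so its kernel is spanned by the other rows of
   [B]. *)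
exists (col i (invmx B)), (W * c); split; first by rewrite mulr_gt0.
move=> w wl; pose u := w *m invmx B.
have -> : w = u *m B by rewrite mulmxKV ?frame_unit.
have ui : u 0 i = 0.
  have wu : col i u = 0 by rewrite -wl !colE mulmxA.
  by have /matrixP/(_ 0 0) := wu; rewrite mxE [RHS]mxE.
rewrite (qform_frame _ BH) -mulrA ler_pM2l //.
apply: (@le_trans _ _ (c * dotv u u)); first by rewrite ler_pM2l // frame_norm_le.
rewrite dotvE mulr_sumr; apply: ler_sum => j _; rewrite -expr2.
have [->|ji] := eqVneq j i; first by rewrite ui expr0n !mulr0.
by rewrite ler_wpM2r ?sqr_ge0 // ck.
Qed.

End Frame.
End QuadraticForms.

(** * Openness of the two index conditions, and connectedness *)

Section Index.
Context {R : realType} {V : normedModType R} {n : nat}.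
Variable H : V -> 'M[R]_n.
Hypothesis cH : forall i j, continuous (fun x => H x i j).

Lemma qform_near x (c : R) : 0 < c -> \forall y \near x,
  forall w, `|qform (H y) w - qform (H x) w| <= c * dotv w w.
Proof.
(* Dividing by n + 1 rather than n also covers n = 0. *)
move=> c0; pose e := c / n.+1%:R.
have e0 : 0 < e by rewrite divr_gt0 ?ltr0n.
have : \forall y \near x, forall ij : 'I_n * 'I_n,
    `|H x ij.1 ij.2 - H y ij.1 ij.2| < e.
  apply: filter_forall => -[i j] /=.
  by have /cvgrPdist_lt/(_ _ e0) := @cH i j x.
apply: filterS => y He w; rewrite -qformB.
apply: le_trans (@qform_bound _ _ _ e _ _) _ => [i j|].
  by rewrite !mxE distrC ltW // (He (i, j)).
rewrite ler_wpM2r ?dotvv_ge0 // /e mulrC mulrAC ler_pdivrMr ?ltr0n //.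
by rewrite ler_pM2l // ler_nat.
Qed.

Lemma open_negative_plane : open [set x | negative_plane (H x)].
Proof.
rewrite openE => x [b1 [b2 [c [c0 free neg]]]].
have c2 : 0 < c / 2 by rewrite divr_gt0.
apply: filterS (qform_near x c2) => y Hy; exists b1, b2, (c / 2); split=> // s t /=.
have := neg s t; have := Hy (s *: b1 + t *: b2); rewrite /= ler_norml => /andP[_].
move: (qform _ _) (qform _ _) (dotv _ _); clear => A B D AB BD; lra.
Qed.

Lemma open_positive_hyperplane : open [set x | positive_hyperplane (H x)].
Proof.
rewrite openE => x [l [c [c0 pos]]].
have c2 : 0 < c / 2 by rewrite divr_gt0.
apply: filterS (qform_near x c2) => y Hy; exists l, (c / 2); split=> // w wl.
have := pos w wl; have := Hy w; rewrite ler_norml => /andP[+ _].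
move: (qform _ _) (qform _ _) (dotv _ _); clear => A B D AB BD; lra.
Qed.

End Index.

(** Pulled back to the line through [x] and [y], [P] is open, closed and nonempty, and the real line
    is connected. *)
Lemma open_dichotomy {R : realType} {V : normedModType R} (P Q : set V) x y :
  open P -> open Q -> (forall z, P z \/ Q z) -> (forall z, P z -> Q z -> False) ->
  P x -> P y.
Proof.
move=> oP oQ PQ disj Px; pose phi (t : R) := x + t *: (y - x).
have cphi : continuous phi.
  move=> t; apply: (@continuousD _ _ _ (cst x) (fun t : R => t *: (y - x))).
    exact: cst_continuous.
  exact: scalel_continuous.
have conn : connected [set: R] by apply/connected_intervalP.
have E : phi @^-1` P = [set: R].
  apply: conn.
  - by exists 0; rewrite /phi /= scale0r addr0.
  - exists (phi @^-1` P); last by rewrite setTI.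
    by apply: open_comp => // t _; exact: cphi.
  - exists (~` (phi @^-1` Q)).
      by apply: open_closedC; apply: open_comp => // t _; exact: cphi.
    rewrite setTI; apply/seteqP; split=> t /=.
      by move=> Pt Qt; exact: disj Pt Qt.
    by have [] := PQ (phi t).
have : (phi @^-1` P) 1 by rewrite E.
by rewrite /phi /= scale1r addrC subrK.
Qed.

(** * Pinching of curvatures and sign patterns *)

Section Pinching.
Context {R : realType} {n : nat}.
Implicit Type k : 'rV[R]_n.

Lemma pinched_curvatures k (e : R) i j : 0 < e -> i != j ->
  k 0 i < 0 -> k 0 j < 0 -> (forall l, k 0 l <= e) ->
  (forall l, k 0 l * (\sum_m k 0 m - k 0 l) < 0) ->
  Num.sqrt (\sum_l k 0 l ^+ 2) <= n%:R ^+ 2 * e.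
Proof.
move=> e0 ij ki kj ke kRic; have n_ge1 : 1 <= n%:R :> R.
  by rewrite ler1n; case: (n) i {ij ki} => // -[].
have ne0 : 0 <= n%:R * e by rewrite mulr_ge0 // ltW.
have lower l : - (n%:R * e) <= k 0 l.
  have [kl|kl] := leP 0 (k 0 l); first by rewrite (le_trans _ kl) // oppr_le0.
  (* One of [i] and [j] differs from [l]; the Ricci condition is then used at that index. *)
  have [m ml km] : exists2 m, m != l & k 0 m < 0.
    by have [<-|il] := eqVneq i l; [exists j; rewrite // eq_sym | exists i].
  have : 0 < \sum_m k 0 m - k 0 m.
    by have := kRic m; rewrite nmulr_rlt0.
  have -> : \sum_h k 0 h = k 0 m + (k 0 l + \sum_(h | (h != m) && (h != l)) k 0 h).
    by rewrite (bigD1 m) //= (bigD1 l) //= eq_sym.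
  rewrite addrC addKr => sum_gt0.
  have : \sum_(h | (h != m) && (h != l)) k 0 h <= n%:R * e.
    apply: (@le_trans _ _ (\sum_(h < n) e)); last first.
      by rewrite sumr_const card_ord mulr_natl.
    rewrite [leRHS](bigID (fun h => (h != m) && (h != l))) /=.
    apply: (@le_trans _ _ (\sum_(h | (h != m) && (h != l)) e)); first exact: ler_sum.
    by rewrite lerDl sumr_ge0 // => *; exact: ltW.
  by move: sum_gt0; move: (\sum_(h | _) _) (n%:R * e) (k 0 l); clear => X Y Z *; lra.
have abs_le l : `|k 0 l| <= n%:R * e.
  rewrite ler_norml lower /= (le_trans (ke l)) // ler_peMl //; exact: ltW.
rewrite -(ger0_norm (_ : 0 <= n%:R ^+ 2 * e)); last first.
  by rewrite mulr_ge0 ?sqr_ge0 // ltW.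
(* The sum of squares is at most n (n e)^2, rounded up to (n^2 e)^2 to avoid a root of n. *)
rewrite -sqrtr_sqr ler_wsqrtr //.
apply: (@le_trans _ _ (\sum_(l < n) (n%:R * e) ^+ 2)).
  apply: ler_sum => l _; rewrite -(real_normK (num_real (k 0 l))).
  by rewrite ler_pXn2r ?nnegrE.
rewrite sumr_const card_ord -[_ *+ n]mulr_natl.
rewrite [leRHS](_ : _ = n%:R * (n%:R * (n%:R * e) ^+ 2)); last by ring.
by rewrite ler_wpM2l // ler_peMl // sqr_ge0.
Qed.

(** The exceptional index is the negative one, or any index if none is negative; n = 0 stands apart
    because it offers no index. *)
Lemma curvature_signs k : (forall i, k 0 i != 0) ->
  (exists i j, [/\ i != j, k 0 i < 0 & k 0 j < 0]) \/
  ((n = 0)%N \/ exists i, forall j, j != i -> 0 < k 0 j).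
Proof.
move=> k0; have [[i [j ij]]|none] :=
  pselect (exists i j, [/\ i != j, k 0 i < 0 & k 0 j < 0]).
  by left; exists i, j.
right; have [/existsP[i ki]|] := boolP [exists i, k 0 i < 0].
  right; exists i => j ji; rewrite lt0r k0 /= leNgt; apply/negP => kj.
  by apply: none; exists j, i.
rewrite negb_exists => /forallP kpos; case: (n) k k0 kpos none => [|m] k' k0 kpos _.
  by left.
by right; exists 0 => j _; rewrite lt0r k0 /= leNgt kpos.
Qed.

(** By [curvature_signs] for [- k], all entries but one are negative, and n >= 3 leaves two of
    them. *)
Lemma two_negative k : (3 <= n)%N -> (forall i, k 0 i != 0) ->
  ~ (exists i j, [/\ i != j, 0 < k 0 i & 0 < k 0 j]) ->
  exists i j, [/\ i != j, k 0 i < 0 & k 0 j < 0].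
Proof.
move=> n3 k0 none.
have Nk0 i : (- k) 0 i != 0 by rewrite mxE oppr_eq0.
have [[i [j [ij]]]|[n0|[i ipos]]] := curvature_signs Nk0.
- by rewrite !mxE !oppr_lt0 => ki kj; case: none; exists i, j.
- by exfalso; rewrite n0 in n3.
have neg j : j != i -> k 0 j < 0 by move=> /ipos; rewrite mxE oppr_gt0.
have : (1 < #|predC1 i|)%N by rewrite cardC1 card_ord -ltnS (ltn_predK n3).
by case/card_gt1P => j [l []]; rewrite !inE => /neg kj /neg kl jl; exists j, l.
Qed.
End Pinching.

(** * Reflection of the graph and points of small curvature *)

Section SmallCurvature.
Context {R : realType} {n : nat}.
Variables (f : 'rV[R]_n -> R).
Hypothesis fC2 : of_class_C 2 f.

Lemma derive_oppf (g : 'rV[R]_n -> R) v : (forall x, differentiable g x) ->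
  'D_v (- g) = - 'D_v g.
Proof.
by move=> dg; apply/funext => x; rewrite deriveN //; exact: diff_derivable.
Qed.

Lemma of_class_C2_opp : of_class_C 2 (- f).
Proof.
have [df ddf] := fC2; split=> [x|v]; first exact: differentiableN.
rewrite derive_oppf //; have [dv cv] := ddf v; split=> [x|w].
  exact: differentiableN.
rewrite derive_oppf // => x; apply: continuousN; exact: cv.
Qed.

Lemma grad_opp x : grad (- f) x = - grad f x.
Proof.
apply/rowP => i; rewrite !mxE deriveN //; apply: diff_derivable; exact: fC2.1.
Qed.

Lemma hessian_opp x : hessian (- f) x = - hessian f x.
Proof.
apply/matrixP => i j; rewrite !mxE derive_oppf; last exact: fC2.1.
by rewrite deriveN //; apply: diff_derivable; exact: (fC2.2 _).1.
Qed.

Lemma slope_opp x : slope (- f) x = slope f x.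
Proof. by rewrite /slope grad_opp dotvNl dotvNr opprK. Qed.

(** The hypothesis is evaluated on the i-th row of [B], which has length 1 in the metric and on
    which the Hessian takes the value W k_i. *)
Lemma curvatures_le x (B : 'M[R]_n) (k : 'rV[R]_n) (e : R) :
  B *m (1%:M + (grad f x)^T *m grad f x) *m B^T = 1%:M ->
  B *m hessian f x *m B^T = slope f x *: diag_mx k ->
  (forall v, 'D_v ('D_v f) x <=
    e * slope f x * (dotv v v + dotv v (grad f x) ^+ 2)) ->
  forall i, k 0 i <= e.
Proof.
move=> Bg BH small i; have := small (delta_mx 0 i *m B).
rewrite (frame_metric Bg) derive2_hessian // -/(qform _ _) (qform_frame _ BH).
have -> : \sum_j k 0 j * (delta_mx 0 i : 'rV[R]_n) 0 j ^+ 2 = k 0 i.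
  rewrite (bigD1 i) //= mxE !eqxx expr1n mulr1 big1 ?addr0 // => j ji.
  by rewrite mxE (negbTE ji) andbF expr0n mulr0.
have -> : dotv (delta_mx 0 i : 'rV[R]_n) (delta_mx 0 i) = 1.
  by rewrite /dotv trmx_delta mul_delta_mx mxE !eqxx.
by rewrite mulr1 [e * _]mulrC ler_pM2l // slope_gt0.
Qed.
End SmallCurvature.

Lemma normA_arbitrarily_small {R : realType} {n : nat} (f : 'rV[R]_n -> R)
    (N : 'rV[R]_(n + 1) -> 'rV[R]_(n + 1)) (e : R) :
  (3 <= n)%N -> of_class_C 2 f -> unit_normal_field f N -> negative_Ricci f N ->
  0 < e -> exists x, normA f N (chart f x) <= n%:R ^+ 2 * e.
Proof.
move=> n3 fC2 N_normal Ric_lt0 e0; have n1 : (1 < n)%N by exact: leq_trans n3.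
have frame x := curvature_frame n1 fC2 N_normal x Ric_lt0.
have k_neq0 (k : 'rV[R]_n) : (forall i, k 0 i * (\sum_j k 0 j - k 0 i) < 0) ->
    forall i, k 0 i != 0.
  by move=> kRic i; apply/eqP => ki; have := kRic i; rewrite ki mul0r ltxx.
have sl x : 0 < slope f x by exact: slope_gt0.
have dichotomy x : negative_plane (hessian f x) \/ positive_hyperplane (hessian f x).
  have [B [k [Bg BH _ kRic]]] := frame x.
  have [[i [j [ij ki kj]]]|[n0|[i kpos]]] := curvature_signs (k_neq0 _ kRic).
  - by left; exact: (frame_negative_plane (sl x) Bg BH ij ki kj).
  - by rewrite n0 in n3.
  - by right; exact: (frame_positive_hyperplane (sl x) Bg BH kpos).
have c_hessian i j : continuous (fun x => hessian f x i j).
  have -> : (fun x => hessian f x i j) = 'D_(delta_mx 0 i) ('D_(delta_mx 0 j) f).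
    by apply/funext => x; rewrite mxE.
  exact: (fC2.2 _).2.
have [x1 small1] := small_curvature_point fC2 e0.
have [x2 small2] := small_curvature_point (of_class_C2_opp fC2) e0.
have [B1 [k1 [Bg1 BH1 A1 Ric1]]] := frame x1.
have k1_le := curvatures_le fC2 Bg1 BH1 small1.
have [[i [j [ij ki kj]]]|pos1] := curvature_signs (k_neq0 _ Ric1).
  by exists x1; rewrite A1; exact: (pinched_curvatures e0 ij).
have [B2 [k2 [Bg2 BH2 A2 Ric2]]] := frame x2.
have k2_le i : - k2 0 i <= e.
  suff : forall l, (- k2) 0 l <= e by move=> /(_ i); rewrite mxE.
  (* Passing to [- f] keeps the metric and [slope] and negates the Hessian, so [B2] is also a frame
     for [- f], with curvatures [- k2]. *)
  apply: (curvatures_le (B := B2) (k := - k2) (of_class_C2_opp fC2) _ _ small2).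
    by rewrite grad_opp // [(- _)^T]linearN /= mulNmx mulmxN opprK.
  rewrite slope_opp // hessian_opp // mulmxN mulNmx BH2.
  by rewrite [diag_mx (- _)]linearN /= scalerN.
have [[i [j [ij ki kj]]]|none] :=
    pselect (exists i j, [/\ i != j, 0 < k2 0 i & 0 < k2 0 j]).
  exists x2; rewrite A2.
  have -> : \sum_l k2 0 l ^+ 2 = \sum_l (- k2) 0 l ^+ 2.
    by apply: eq_bigr => l _; rewrite mxE sqrrN.
  apply: (pinched_curvatures e0 ij); rewrite ?mxE ?oppr_lt0 // => l.
    by rewrite mxE.
  rewrite mxE (eq_bigr (fun m => - k2 0 m)) => [|m _]; last by rewrite mxE.
  by rewrite sumrN -opprD mulrNN.
(* In the remaining case [x2] has a negative plane and [x1] a positive hyperplane. Connectedness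
   carries the negative plane from [x2] to [x1], a contradiction. *)
have [i [j [ij ki kj]]] := two_negative n3 (k_neq0 _ Ric2) none.
have neg2 := frame_negative_plane (sl x2) Bg2 BH2 ij ki kj.
case: pos1 => [n0|[i1 pos1]]; first by rewrite n0 in n3.
have pos_x1 := frame_positive_hyperplane (sl x1) Bg1 BH1 pos1.
have disjoint z :
    negative_plane (hessian f z) -> positive_hyperplane (hessian f z) -> False.
  exact: negative_plane_positive_hyperplane.
have neg_x1 := @open_dichotomy _ _ [set x | negative_plane (hessian f x)]
  [set x | positive_hyperplane (hessian f x)] x2 x1
  (open_negative_plane c_hessian) (open_positive_hyperplane c_hessian)
  dichotomy disjoint neg2.
by have := disjoint _ neg_x1 pos_x1.
Qed.

Unset Implicit Arguments.

Theorem corollary1p5 (R : realType) (n : nat) (f : 'rV[R]_n -> R)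
    (N : 'rV[R]_(n + 1) -> 'rV[R]_(n + 1))
    (n_ge3 : (3 <= n)%N)
    (f_C2 : of_class_C 2 f)
    (N_normal : unit_normal_field f N)
    (Ric_lt0 : negative_Ricci f N) :
  inf [set normA f N p | p in graph f] = 0.
Proof.
set S := [set _ | _ in _].
have lb0 : lbound S 0 by move=> _ [p _ <-]; exact: sqrtr_ge0.
have S0 : S !=set0 by exists (normA f N (chart f 0)), (chart f 0) => //; exists 0.
apply/eqP; rewrite eq_le lb_le_inf // andbT; apply/ler_addgt0Pl => e e0.
have n2 : 0 < n%:R ^+ 2 :> R by rewrite exprn_gt0 // ltr0n (leq_trans _ n_ge3).
have en : 0 < e / n%:R ^+ 2 by rewrite divr_gt0.
have [x xe] := normA_arbitrarily_small n_ge3 f_C2 N_normal Ric_lt0 en.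
rewrite addr0; apply: (@le_trans _ _ (normA f N (chart f x))).
  by apply: ge_inf; [exists 0 | exists (chart f x) => //; exists x].
by rewrite (le_trans xe) // mulrC divfK // gt_eqF.
Qed.
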